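(* Let $\Omega$ be a (possibly unbounded) smooth domain in $\mathbf{R}^N$ $(N\ge1)$ and let $p,q\ge0$. Consider the problem $$(\ast)\quad \partial_t u=\Delta u+v^p,\quad \partial_t v=\Delta v+u^q\ \text{ in }\Omega\times(0,\infty),\qquad u=v=0\ \text{ on }\partial\Omega\times(0,\infty),\qquad (u,v)(\cdot,0)=(u_0,v_0)$$ with nonnegative initial functions. (i) If $pq\le1$, then $(\ast)$ possesses a global-in-time solution for any (nonnegative) initial function $(u_0,v_0)\in L^\infty(\Omega)\times L^\infty(\Omega)$. (ii) Assume that there exists a constant $p_*(\Omega)>1$ with the following properties, concerning the scalar problem $$(\ast\ast)\quad \partial_t w=\Delta w+\alpha w^A+\beta w^B\ \text{ in }\Omega\times(0,\infty),\qquad w=0\ \text{ on }\partial\Omega\times(0,\infty),\qquad w(\cdot,0)=w_0\ge0,$$ with $\alpha,\beta\ge1$ and $A,B\ge0$: (a) if $1<\min\{A,B\}\le p_*(\Omega)$, then $(\ast\ast)$ has no global-in-time positive solutions; (b) if $p_*(\Omega)<\min\{A,B\}<\infty$, then $(\ast\ast)$ possesses a global-in-time positive solution for some initial function $w_0$. Then $(\ast)$ possesses a global-in-time positive solution for some initial function $(u_0,v_0)$ if $$\frac{pq-1}{\max\{p,q\}+1}>p_*(\Omega)-1.$$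
   Context: $S(t)$ is the Dirichlet heat semigroup on $\Omega$ (integration against the Dirichlet heat kernel of $\Omega$). Initial functions are nonnegative and locally integrable. A global-in-time solution of $(\ast)$ is a pair $(u,v)$ of nonnegative measurable functions on $\Omega\times(0,\infty)$, bounded on $\Omega\times(\tau,\tau')$ for all $0<\tau<\tau'<\infty$, such that for almost all $x\in\Omega$ and $t\in(0,\infty)$, $$u(x,t)=[S(t)u_0](x)+\int_0^t[S(t-s)v(s)^p](x)\,ds<\infty,\qquad v(x,t)=[S(t)v_0](x)+\int_0^t[S(t-s)u(s)^q](x)\,ds<\infty.$$ Similarly, a global-in-time solution of $(\ast\ast)$ is a nonnegative measurable function $w$ with the same boundedness property and $w(x,t)=[S(t)w_0](x)+\int_0^t[S(t-s)(\alpha w(s)^A+\beta w(s)^B)](x)\,ds<\infty$ for almost all $x\in\Omega$, $t>0$. A solution is positive if its components are positive in $\Omega\times(0,\infty)$. *)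

(* Defs.v *)
From HB Require Import structures.
From mathcomp Require Import all_boot all_order all_algebra.
From mathcomp Require Import all_classical all_reals all_analysis.

Set Implicit Arguments.
Unset Strict Implicit.
Unset Printing Implicit Defensive.

Import Order.TTheory GRing.Theory Num.Theory.
Import numFieldNormedType.Exports.

Local Open Scope classical_set_scope.
Local Open Scope ring_scope.

(* The library has no measurable structure and no Lebesgue measure on R^n.
   'rV[R]_n gets the sigma-algebra generated by the coordinates (the Borel
   sets), as the library does for n.-tuple R; the Lebesgue measure is then
   obtained by iterating the product with the one-dimensional one. *)
Section row_vector_measurable.
Context {R : realType} (n : nat).

Let coord (i : 'I_n) (x : 'rV[R]_n) : measurableTypeR R := x ord0 i.

Let rV_set0 : g_sigma_preimage coord set0.
Proof. exact: sigma_algebra0. Qed.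

Let rV_setC A : g_sigma_preimage coord A -> g_sigma_preimage coord (~` A).
Proof. exact: sigma_algebraC. Qed.

Let rV_bigcup (F : (set 'rV[R]_n)^nat) :
  (forall i, g_sigma_preimage coord (F i)) ->
  g_sigma_preimage coord (\bigcup_i (F i)).
Proof. exact: sigma_algebra_bigcup. Qed.

HB.instance Definition _ := @isMeasurable.Build
  (measure_tuple_display default_measure_display) 'rV[R]_n
  (g_sigma_preimage coord) rV_set0 rV_setC rV_bigcup.

End row_vector_measurable.

Section row_vector_measurable_fun.
Context {R : realType}.

Lemma measurable_rV_coord n (i : 'I_n) :
  measurable_fun [set: 'rV[R]_n] (fun x => x ord0 i : measurableTypeR R).
Proof.
move=> _ Y mY; rewrite setTI; apply: sub_sigma_algebra => /=.
rewrite -bigcup_seq/=; exists i => /=; first by rewrite mem_index_enum.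
by exists Y => //; rewrite setTI.
Qed.

Lemma measurable_fun_rVP d (T : measurableType d) n (f : T -> 'rV[R]_n) :
  (forall i, measurable_fun [set: T] (fun x => f x ord0 i : measurableTypeR R)) ->
  measurable_fun [set: T] f.
Proof.
move=> mf.
suff H : g_sigma_preimage
    (fun i : 'I_n => (fun x => x ord0 i : measurableTypeR R) \o f) `<=` measurable.
  move=> _ A mA; rewrite setTI; apply: H.
  rewrite (@g_sigma_preimage_comp _ _ n 'rV[R]_n
    (fun i x => x ord0 i : measurableTypeR R) T f).
  by exists A => //; rewrite setTI.
apply: smallest_sub; first exact: sigma_algebra_measurable.
case: n => [|n] in f mf *; first by rewrite big_ord0.
rewrite -bigcup_mkord_ord; apply: bigcup_sub => i Ii A [B mB <-].
exact: mf.
Qed.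

Definition rV_cons n (z : measurableTypeR R * 'rV[R]_n) : 'rV[R]_n.+1 :=
  row_mx (const_mx z.1 : 'rV[R]_1) z.2.

Definition rV_uncons n (x : 'rV[R]_n.+1) : measurableTypeR R * 'rV[R]_n :=
  (x ord0 ord0, \row_(i < n) x ord0 (lift ord0 i)).

Lemma rV_unconsK n : cancel (@rV_uncons n) (@rV_cons n).
Proof.
move=> x; apply/rowP => i; rewrite /rV_cons /rV_uncons mxE /=.
case: splitP => j /= ij; rewrite !mxE; congr (x _ _); apply: val_inj => /=.
  by rewrite ij; case: j {ij} => [[]].
by rewrite ij /bump add1n.
Qed.

Lemma rV_consK n : cancel (@rV_cons n) (@rV_uncons n).
Proof.
move=> [a x]; rewrite /rV_uncons /rV_cons; congr (_, _).
  have -> : ord0 = lshift n (ord0 : 'I_1) by exact: val_inj.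
  by rewrite [LHS]row_mxEl mxE.
apply/rowP => i; rewrite mxE.
have -> : lift ord0 i = rshift 1 i by exact: val_inj.
by rewrite [LHS]row_mxEr.
Qed.

Lemma measurable_rV_cons n : measurable_fun setT (@rV_cons n).
Proof.
apply: measurable_fun_rVP => i; rewrite /rV_cons.
have [j ->|j ->] := @split_ordP 1 n i.
  rewrite (_ : (fun _ => _) = fst); first exact: measurable_fst.
  by apply/funext => z; rewrite [LHS]row_mxEl mxE.
rewrite (_ : (fun _ => _) =
    fun z : measurableTypeR R * 'rV[R]_n => z.2 ord0 j); last first.
  by apply/funext => z; rewrite [LHS]row_mxEr.
apply: (@measurableT_comp _ _ _ _ _ _ (fun x : 'rV[R]_n => x ord0 j)) => //.
exact: measurable_rV_coord.
Qed.

Lemma measurable_rV_uncons n : measurable_fun setT (@rV_uncons n).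
Proof.
apply/measurable_fun_pairP; split => /=; first exact: measurable_rV_coord.
apply: measurable_fun_rVP => i /=.
under eq_fun do rewrite mxE.
exact: measurable_rV_coord.
Qed.

End row_vector_measurable_fun.

Section lebesgue_rV.
Context {R : realType}.
Local Open Scope ereal_scope.

Section cons.
Variables (n : nat) (m : {sigma_finite_measure set 'rV[R]_n -> \bar R}).

Definition lebesgue_rV_cons : set 'rV[R]_n.+1 -> \bar R :=
  pushforward (@lebesgue_measure R \x m) (@rV_cons R n).

Let mpre (A : set 'rV[R]_n.+1) :
  measurable A -> measurable (@rV_cons R n @^-1` A).
Proof.
by move=> mA; rewrite -[X in measurable X]setTI; exact: measurable_rV_cons.
Qed.

Let cons0 : lebesgue_rV_cons set0 = 0.
Proof. by rewrite /lebesgue_rV_cons /pushforward preimage_set0 measure0. Qed.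

Let cons_ge0 A : 0 <= lebesgue_rV_cons A.
Proof. by rewrite /lebesgue_rV_cons /pushforward measure_ge0. Qed.

Let cons_sigma_additive : semi_sigma_additive lebesgue_rV_cons.
Proof.
move=> F mF tF mUF; rewrite /lebesgue_rV_cons /pushforward preimage_bigcup.
apply: measure_semi_sigma_additive.
- move=> k.
  exact: (@mpre (F k)).
- apply/trivIsetP => i j _ _ ij; rewrite -preimage_setI.
  by move/trivIsetP : tF => /(_ _ _ I I ij) ->; rewrite preimage_set0.
- by rewrite -preimage_bigcup; apply: mpre.
Qed.

HB.instance Definition _ := isMeasure.Build _ _ _ lebesgue_rV_cons
  cons0 cons_ge0 cons_sigma_additive.

Let cons_sigma_finite : sigma_finite setT lebesgue_rV_cons.
Proof.
have /sigma_finiteP[F [UF ndF Foo]] := sigma_finiteT (@lebesgue_measure R).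
have /sigma_finiteP[G [UG ndG Goo]] := sigma_finiteT m.
exists (fun k => @rV_uncons R n @^-1` (F k `*` G k)).
  apply/esym/seteqP; split => // x _.
  have [i _ Fi] : (\bigcup_i F i) (rV_uncons x).1 by rewrite -UF.
  have [j _ Gj] : (\bigcup_j G j) (rV_uncons x).2 by rewrite -UG.
  exists (maxn i j) => //; split.
  - by move: Fi; exact/subsetPset/ndF/leq_maxl.
  - by move: Gj; exact/subsetPset/ndG/leq_maxr.
move=> k; have [mFk Fk] := Foo k; have [mGk Gk] := Goo k; split.
  rewrite -[X in measurable X]setTI.
  by apply: measurable_rV_uncons => //; exact: measurableX.
rewrite /lebesgue_rV_cons /pushforward -comp_preimage.
rewrite (_ : _ \o _ = id); last by apply/funext => z /=; exact: rV_consK.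
by rewrite preimage_id product_measure1E// lte_mul_pinfty// ge0_fin_numE.
Qed.

HB.instance Definition _ := Measure_isSigmaFinite.Build _ _ _ lebesgue_rV_cons
  cons_sigma_finite.

End cons.

Fixpoint lebesgue_rV (n : nat) : {sigma_finite_measure set 'rV[R]_n -> \bar R} :=
  match n with
  | 0 => dirac (0%R : 'rV[R]_0)
  | n'.+1 => lebesgue_rV_cons (lebesgue_rV n')
  end.

End lebesgue_rV.

Section smooth_domain.
Context {R : realType} {N : nat}.
Local Notation V := 'rV[R]_N.

Definition partial (i : 'I_N) (f : V -> R) (x : V) : R :=
  'D_(delta_mx ord0 i) f x.

Fixpoint Ck (k : nat) (U : set V) (f : V -> R) : Prop :=
  {within U, continuous f} /\
  match k with
  | 0 => True
  | k'.+1 => forall i, (forall x, U x -> derivable f x (delta_mx ord0 i)) /\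
                       Ck k' U (partial i f)
  end.

Definition boundary (Omega : set V) : set V := closure Omega `\` Omega°.

(* Near each boundary point the domain is the sublevel set {rho < 0} of a
   C^infty defining function with nonvanishing gradient. *)
Definition smooth_domain (Omega : set V) : Prop :=
  [/\ open Omega, connected Omega, Omega !=set0 &
    forall x, boundary Omega x -> exists (U : set V) (rho : V -> R),
      [/\ open U, U x, (forall k, Ck k U rho),
          (exists i, partial i rho x != 0) &
          Omega `&` U = [set y | rho y < 0] `&` U]].

End smooth_domain.

Section heat.
Context {R : realType} {N : nat}.
Local Notation V := 'rV[R]_N.
Local Notation leb := (@lebesgue_rV R N).

Implicit Types (Omega : set V) (G : R -> V -> V -> R).

Definition halfline : set R := `]0, +oo[%classic.

Definition heat_semigroup Omega G (t : R) (f : V -> R) (x : V) : \bar R :=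
  (\int[leb]_(y in Omega) (G t x y * f y)%:E)%E.

(* Classical (C^{2,1}) solutions of u_t = Laplacian u in Omega x (0, oo). *)
Definition heat_equation Omega (u : R -> V -> R) : Prop :=
  let Q := halfline `*` Omega in
  let cont (f : R -> V -> R) :=
    {within Q, continuous (fun z : R * V => f z.1 z.2)} in
  [/\ cont u /\ cont (fun t x => 'D_1 (u ^~ x) t),
      forall i, cont (fun t => partial i (u t)),
      forall i j, cont (fun t => partial j (partial i (u t))) &
      forall t x, Q (t, x) ->
        [/\ derivable (u ^~ x) t 1,
            forall i, derivable (u t) x (delta_mx ord0 i),
            forall i j, derivable (partial i (u t)) x (delta_mx ord0 j) &
            'D_1 (u ^~ x) t = \sum_(i < N) partial i (partial i (u t)) x]].

Definition test_function Omega (phi : V -> R) : Prop :=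
  continuous phi /\
  exists K, [/\ compact K, K `<=` Omega & forall x, ~ K x -> phi x = 0].

(* [G t x y] is the heat kernel of Omega with zero Dirichlet condition: the
   positive symmetric sub-Markovian transition density which, for each pole y,
   solves the heat equation in (t, x), vanishes on the boundary and tends to
   the Dirac mass as t -> 0+.  These properties determine G on
   (0, oo) x Omega x Omega; its other values are never used. *)
Record dirichlet_heat_kernel Omega G : Prop := {
  dhk_gt0 : forall (t : R) x y, 0 < t -> Omega x -> Omega y -> 0 < G t x y ;
  dhk_sym : forall (t : R) x y, 0 < t -> Omega x -> Omega y ->
    G t x y = G t y x ;
  dhk_le1 : forall (t : R) x, 0 < t -> Omega x ->
    (\int[leb]_(y in Omega) (G t x y)%:E <= 1)%E ;
  dhk_semigroup : forall (s t : R) x y, 0 < s -> 0 < t -> Omega x -> Omega y ->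
    (\int[leb]_(z in Omega) (G s x z * G t z y)%:E = (G (s + t) x y)%:E)%E ;
  dhk_continuous : {within halfline `*` (Omega `*` Omega),
    continuous (fun z : R * (V * V) => G z.1 z.2.1 z.2.2)} ;
  dhk_heat : forall y, Omega y -> heat_equation Omega (fun t x => G t x y) ;
  dhk_boundary : forall (t : R) x y, 0 < t -> boundary Omega x -> Omega y ->
    G z.1 z.2.1 z.2.2
      @[z --> within (halfline `*` (Omega `*` Omega)) (nbhs (t, (x, y)))]
      --> (0 : R) ;
  dhk_initial : forall phi x, test_function Omega phi -> Omega x ->
    heat_semigroup Omega G t phi x @[t --> 0^'+] --> (phi x)%:E
}.

Definition initial_function Omega (f : V -> R) : Prop :=
  [/\ measurable_fun Omega f, (forall x, Omega x -> 0 <= f x) &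
      forall K, K `<=` Omega -> compact K ->
        (\int[leb]_(x in K) (f x)%:E < +oo)%E].

Definition ess_bounded Omega (f : V -> R) : Prop :=
  measurable_fun Omega f /\
  exists M : R, {ae leb, forall x, Omega x -> `|f x| <= M}.

Definition admissible Omega (u : V -> R -> R) : Prop :=
  [/\ measurable_fun (Omega `*` (halfline : set (measurableTypeR R)))
        (fun z => u z.1 z.2),
      (forall x (t : R), Omega x -> 0 < t -> 0 <= u x t) &
      forall t1 t2 : R, 0 < t1 -> t1 < t2 ->
        exists M : R, forall x (t : R), Omega x -> t1 < t < t2 -> u x t <= M].

(* The integral equation with initial function [u0] and source term [f], almost
   everywhere in Omega x (0, oo).  As [u] is real-valued, the right-hand side
   is finite wherever the equation holds. *)
Definition duhamel Omega G (u0 : V -> R) (f u : V -> R -> R) : Prop :=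
  {ae (leb \x @lebesgue_measure R)%E, forall z : V * R,
    (Omega `*` halfline) z ->
    ((u z.1 z.2)%:E = heat_semigroup Omega G z.2 u0 z.1 +
      \int[@lebesgue_measure R]_(s in `]0%R, z.2[)
        heat_semigroup Omega G (z.2 - s) (f ^~ s) z.1)%E}.

(* [powR] has [0 `^ 0 = 1], so that [v ^ p] is the constant 1 if [p = 0]. *)
Definition system_solution Omega G (p q : R) (u0 v0 : V -> R)
    (u v : V -> R -> R) : Prop :=
  [/\ admissible Omega u, admissible Omega v,
      duhamel Omega G u0 (fun x t => v x t `^ p) u &
      duhamel Omega G v0 (fun x t => u x t `^ q) v].

Definition scalar_solution Omega G (alpha beta A B : R) (w0 : V -> R)
    (w : V -> R -> R) : Prop :=
  admissible Omega w /\
  duhamel Omega G w0 (fun x t => alpha * w x t `^ A + beta * w x t `^ B) w.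

Definition positive_on Omega (u : V -> R -> R) : Prop :=
  forall x (t : R), Omega x -> 0 < t -> 0 < u x t.

Definition has_positive_scalar_solution Omega G (alpha beta A B : R) : Prop :=
  exists w0 w, [/\ initial_function Omega w0,
    scalar_solution Omega G alpha beta A B w0 w & positive_on Omega w].

End heat.

(* Main.v *)
From HB Require Import structures.
Require Import Defs.
From mathcomp Require Import all_boot all_order all_algebra.
From mathcomp Require Import all_classical all_reals all_analysis.
From mathcomp Require Import measurable_realfun.
From mathcomp Require Import ring lra.
Set Implicit Arguments.
Unset Strict Implicit.
Unset Printing Implicit Defensive.
Import Order.TTheory GRing.Theory Num.Theory.
Import numFieldNormedType.Exports.
Local Open Scope classical_set_scope.
Local Open Scope ring_scope.

(** Both parts reduce to exhibiting a supersolution of the integral equations.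
    With [S] the heat semigroup acting on initial data and [K] the Duhamel
    operator, both integral operators with nonnegative kernels on space-time,
    a solution is a pair with [u = S u0 + K (v `^ p)] and
    [v = S v0 + K (u `^ q)].  Iterating the right-hand sides from zero gives an
    increasing sequence, which converges to a solution as soon as some pair
    lies above its right-hand sides ([solution_below_supersolution]).

    If [p * q <= 1] and the data are bounded by [M], the pair
    [((M + 1) e^(a t), (M + 1) e^(b t))] is such a supersolution for suitable
    rates ([global_solution_bounded_data]).

    In the second part one may assume [q <= p], by symmetry.  Put
    [th = (q + 1) / (p + 1)], which is at most one, and
    [A = p (q + 1) / (p + 1)], so that [A - 1 = (p q - 1) / (p + 1)] and the
    hypothesis is [pstar < A].  The scalar problem with both exponents equal to
    [A] and both coefficients equal to [th^-1] then has a positive solution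
    [W], and [(W, W `^ th)] is a supersolution of the system: formally
    [(d_t - Delta) (W `^ th) >= th W `^ (th - 1) (d_t - Delta) W], since
    [th <= 1], and the right-hand side is [2 W `^ (th - 1 + A) = 2 W `^ q].

    As [W] only satisfies an integral equation, this chain rule is proved with
    the resolvents [P = lam (lam + L)^-1] of the heat operator [L = K^-1],
    whose kernel is that of [K] with the weight [lam e^(- lam (t - s))].  Since
    [P] is sub-Markovian, the tangent of the concave power at [W z] gives
    [P (W `^ th) <= W `^ th + th W `^ (th - 1) (P W - W)], while
    [W - P W >= lam^-1 P F] for the source [F] of [W].  Applying [lam K] and
    the resolvent equation [lam K = P + lam K P] yields
    [th K (W `^ (th - 1) P F) <= W `^ th] ([kop_concave_power]).  It remains to
    let [lam] tend to infinity.  Here [F] is a multiple of a convex power of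
    [W], so the same tangent argument bounds [P F] from below in terms of
    [P W], and [P W] converges to [W] pointwise because [W - P W] is explicit;
    Fatou's lemma concludes ([duhamel_powR_le]).  No regularity of [W] enters.

    Since the given scalar solution may be unbounded at the initial time, and
    may have vanishing initial data, it is first restarted at a positive time
    ([scalar_solution_restart]).  Its value there serves as [u0], with
    [v0 = 0]; positivity of [u] and then of [v] follows from that of the heat
    kernel. *)

Lemma measurable_fine_comp d (T : measurableType d) (R : realType)
    (g : T -> \bar R) :
  measurable_fun setT g -> measurable_fun setT (fun z => fine (g z)).
Proof.
by move=> mg; apply: (measurableT_comp _ mg); exact: fine_measurable.
Qed.

(** * Integral operators with nonnegative kernels *)

Section kernel_operator.
Local Open Scope ereal_scope.
Context {R : realType}.

Definition kernel_fun d1 d2 (X : measurableType d1) (Y : measurableType d2)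
    (k : X -> Y -> \bar R) : Prop :=
  (forall x y, 0 <= k x y) /\ measurable_fun setT (fun z : X * Y => k z.1 z.2).

Definition kop d (X : Type) (Y : measurableType d)
    (m : {sigma_finite_measure set Y -> \bar R}) (k : X -> Y -> \bar R)
    (f : Y -> \bar R) (x : X) : \bar R :=
  \int[m]_y (k x y * f y).

Section one.
Context d1 d2 (X : measurableType d1) (Y : measurableType d2).
Variable m : {sigma_finite_measure set Y -> \bar R}.
Implicit Types (k : X -> Y -> \bar R) (f h : Y -> \bar R).

Lemma measurable_kernel_section k x : kernel_fun k ->
  measurable_fun setT (k x).
Proof.
by move=> [_ mk]; exact: (measurable_fun_pair2 x mk).
Qed.

Let mkf k f x : kernel_fun k -> measurable_fun setT f ->
  measurable_fun setT (fun y => k x y * f y).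
Proof.
by move=> hk mf; exact: emeasurable_funM (measurable_kernel_section _ hk) mf.
Qed.

Lemma kop_ge0 k f x : kernel_fun k -> (forall y, 0 <= f y) -> 0 <= kop m k f x.
Proof. by move=> [k0 _] f0; apply: integral_ge0 => y _; rewrite mule_ge0. Qed.

Lemma measurable_kop k f : kernel_fun k -> measurable_fun setT f ->
  (forall y, 0 <= f y) -> measurable_fun setT (kop m k f).
Proof.
move=> [k0 mk] mf f0.
apply: (@measurable_fun_fubini_tonelli_F _ _ _ _ _ _
  (fun z : X * Y => k z.1 z.2 * f z.2)) => [|z].
  by apply: emeasurable_funM => //; apply: measurableT_comp.
by rewrite mule_ge0.
Qed.

(** Requiring the comparison only where the kernel is positive allows bounds
    that hold on the past of a space-time point alone. *)
Lemma kop_le k f h x : kernel_fun k -> measurable_fun setT f ->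
  measurable_fun setT h -> (forall y, 0 <= f y) ->
  (forall y, 0 < k x y -> f y <= h y) -> kop m k f x <= kop m k h x.
Proof.
move=> hk mf mh f0 fh; have [k0 mk] := hk.
apply: ge0_le_integral => //.
- by move=> y _; rewrite mule_ge0.
- exact: mkf.
- exact: mkf.
move=> y _; have [ky|ky] := eqVneq (k x y) 0; first by rewrite ky !mul0e.
by apply: lee_wpmul2l => //; apply: fh; rewrite lt_neqAle eq_sym ky k0.
Qed.

Lemma eq_kop k f h x : (forall y, 0 <= k x y) ->
  (forall y, 0 < k x y -> f y = h y) -> kop m k f x = kop m k h x.
Proof.
move=> k0 fh; apply: eq_integral => y _.
have [->|ky] := eqVneq (k x y) 0; first by rewrite !mul0e.
by rewrite fh// lt_neqAle eq_sym ky k0.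
Qed.

Lemma kopD k f h x : kernel_fun k -> measurable_fun setT f ->
  measurable_fun setT h -> (forall y, 0 <= f y) -> (forall y, 0 <= h y) ->
  kop m k (fun y => f y + h y) x = kop m k f x + kop m k h x.
Proof.
move=> hk mf mh f0 h0; have [k0 _] := hk.
rewrite /kop -ge0_integralD//; last 4 first.
- by move=> y _; rewrite mule_ge0.
- exact: mkf.
- by move=> y _; rewrite mule_ge0.
- exact: mkf.
by apply: eq_integral => y _; rewrite ge0_muleDr.
Qed.

Lemma kopZ k f x (a : R) : kernel_fun k -> measurable_fun setT f ->
  (forall y, 0 <= f y) -> (0 <= a)%R ->
  kop m k (fun y => a%:E * f y) x = a%:E * kop m k f x.
Proof.
move=> hk mf f0 a0; have [k0 _] := hk.
rewrite /kop -ge0_integralZl//; last 2 first.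
- exact: mkf.
- by move=> y _; rewrite mule_ge0.
by apply: eq_integral => y _; rewrite muleCA.
Qed.

Lemma ae_eq_kop k f h x : kernel_fun k -> measurable_fun setT f ->
  measurable_fun setT h -> (forall y, 0 <= f y) -> (forall y, 0 <= h y) ->
  {ae m, forall y, 0 < k x y -> f y = h y} -> kop m k f x = kop m k h x.
Proof.
move=> hk mf mh f0 h0 fh; have [k0 _] := hk.
apply: ge0_ae_eq_integral => //; [exact: mkf|exact: mkf| | |].
- by move=> y _; rewrite mule_ge0.
- by move=> y _; rewrite mule_ge0.
apply: filterS fh => y fh _.
have [->|ky] := eqVneq (k x y) 0; first by rewrite !mul0e.
by rewrite fh// lt_neqAle eq_sym ky k0.
Qed.

End one.

(** Tonelli's theorem. *)
Lemma kop_comp d1 d2 d3 (X : measurableType d1) (Y : measurableType d2)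
    (Z : measurableType d3) (m : {sigma_finite_measure set Y -> \bar R})
    (n : {sigma_finite_measure set Z -> \bar R})
    (k : X -> Y -> \bar R) (l : Y -> Z -> \bar R) (f : Z -> \bar R) x :
  kernel_fun k -> kernel_fun l -> measurable_fun setT f ->
  (forall z, 0 <= f z) ->
  kop m k (kop n l f) x = kop n (fun x z => \int[m]_y (k x y * l y z)) f x.
Proof.
move=> hk hl mf f0; have [k0 _] := hk; have [l0 ml] := hl.
have mkx := measurable_kernel_section x hk.
have mklf : measurable_fun setT (fun w : Y * Z => k x w.1 * (l w.1 w.2 * f w.2)).
  apply: emeasurable_funM; first exact: measurableT_comp mkx measurable_fst.
  by apply: emeasurable_funM => //; exact: measurableT_comp mf measurable_snd.
have -> : kop m k (kop n l f) x = \int[m]_y \int[n]_z (k x y * (l y z * f z)).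
  apply: eq_integral => y _; rewrite ge0_integralZl//.
  - by apply: emeasurable_funM => //; exact: measurable_kernel_section.
  - by move=> z _; rewrite mule_ge0.
have := @fubini_tonelli _ _ _ _ _ m n
  (fun w : Y * Z => k x w.1 * (l w.1 w.2 * f w.2)) mklf.
move=> -> /=; last by move=> w; rewrite !mule_ge0.
apply: eq_integral => z _; under eq_integral do rewrite muleA.
rewrite ge0_integralZr//.
- apply: emeasurable_funM => //.
  exact: (measurable_fun_pair1 z ml).
- by move=> y _; rewrite mule_ge0.
Qed.

(** Fatou's lemma. *)
Lemma le_kop_lim d1 d2 (X : measurableType d1) (Y : measurableType d2)
    (m : {sigma_finite_measure set Y -> \bar R}) (k : X -> Y -> \bar R)
    (f_ : (Y -> \bar R)^nat) (f : Y -> \bar R) x (C : \bar R) :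
  kernel_fun k -> (forall n, measurable_fun setT (f_ n)) ->
  (forall n y, 0 <= f_ n y) -> (forall y, k x y \is a fin_num) ->
  (forall y, 0 < k x y -> f_ n y @[n --> \oo] --> f y) ->
  (forall n, kop m k (f_ n) x <= C) -> kop m k f x <= C.
Proof.
move=> hk mf f0 kfin ff fC; have [k0 _] := hk.
have cvkf y : k x y * f_ n y @[n --> \oo] --> k x y * f y.
  have [->|ky] := eqVneq (k x y) 0.
    by under eq_fun do rewrite mul0e; rewrite mul0e; exact: cvg_cst.
  by apply: cvgeZl => //; apply: ff; rewrite lt_neqAle eq_sym ky k0.
have -> : kop m k f x = \int[m]_y limn_einf (fun n => k x y * f_ n y).
  apply: eq_integral => y _; rewrite is_cvg_limn_einfE; last first.
    by apply/cvg_ex; eexists; exact: cvkf.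
  by apply/esym/cvg_lim => //; exact: cvkf.
apply: le_trans; first apply: fatou => //.
- by move=> n; apply: emeasurable_funM => //; exact: measurable_kernel_section.
- by move=> n y _; rewrite mule_ge0.
rewrite limn_einf_lim; apply: lime_le; first exact: is_cvg_einfs.
apply: nearW => n; apply: le_trans (fC n).
by apply: ereal_inf_lbound; exists n => //=.
Qed.

End kernel_operator.

(** * Powers of potentials *)

Section powR_tangent.
Context {R : realType}.
Implicit Types a y A th : R.

(** Young's inequality for [y `^ th] and [a `^ (1 - th)]: a concave power lies
    below its tangents. *)
Lemma powR_le_tangent th a y : 0 < th <= 1 -> 0 < a -> 0 <= y ->
  y `^ th <= (1 - th) * a `^ th + th * a `^ (th - 1) * y.
Proof.
move=> /andP[th0 th1] a0 y0.
have [->|thN1] := eqVneq th 1.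
  by rewrite !subrr mul0r add0r powRr0 mulr1 mul1r powRr1.
have th1' : 0 < 1 - th by rewrite subr_gt0 lt_neqAle thN1.
have : y `^ th * a `^ (1 - th) <= th * y + (1 - th) * a.
  have := @conjugate_powR _ (y `^ th) (a `^ (1 - th)) th^-1 (1 - th)^-1
    (powR_ge0 _ _) (powR_ge0 _ _).
  rewrite !invr_gt0 !invrK -!powRrM !divff ?gt_eqF// !powRr1//; last exact: ltW.
  move=> /(_ th0 th1'); rewrite addrC subrK => /(_ erefl).
  by rewrite (mulrC y) (mulrC a).
move=> /(ler_wpM2r (powR_ge0 a (th - 1))).
rewrite -(mulrA (y `^ th)) -powRD; last by rewrite (gt_eqF a0) implybT.
rewrite (_ : 1 - th + (th - 1) = 0); last by ring.
rewrite powRr0 mulr1 => /le_trans; apply.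
rewrite mulrDl addrC -!mulrA (mulr_powRB1 (ltW a0) th0).
by rewrite (mulrC y).
Qed.

(** The previous tangent inequality for the inverse power [th = A^-1], at
    [a `^ A] and [y `^ A]. *)
Lemma powR_ge_tangent A a y : 1 <= A -> 0 < a -> 0 <= y ->
  A * a `^ (A - 1) * y <= y `^ A + (A - 1) * a `^ A.
Proof.
move=> A1 a0 y0; have A0 : 0 < A by lra.
have /(powR_le_tangent (a := a `^ A) (y := y `^ A)) : 0 < A^-1 <= 1.
  by rewrite invr_gt0 A0 invf_le1.
rewrite powR_gt0// => /(_ erefl (powR_ge0 _ _)).
rewrite -!powRrM divff ?gt_eqF// !powRr1//; last exact: ltW.
have -> : A * (A^-1 - 1) = 1 - A by field; lra.
have c0 : 0 <= A * a `^ (A - 1) by rewrite mulr_ge0 ?powR_ge0// ltW.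
move=> /(ler_wpM2l c0) /le_trans; apply.
have E1 : a `^ (A - 1) * a `^ (1 - A) = 1.
  rewrite -powRD; last by rewrite (gt_eqF a0) implybT.
  by rewrite (_ : A - 1 + (1 - A) = 0) ?powRr0//; ring.
have E2 : a * a `^ (A - 1) = a `^ A by rewrite mulr_powRB1// ltW.
rewrite le_eqVlt; apply/orP; left; apply/eqP.
transitivity ((A - 1) * (a * a `^ (A - 1)) +
  a `^ (A - 1) * a `^ (1 - A) * y `^ A); first by field; lra.
by rewrite E1 E2; ring.
Qed.

End powR_tangent.

Section concave_potential.
Local Open Scope ereal_scope.
Context d (T : measurableType d) {R : realType}.
Variable m : {sigma_finite_measure set T -> \bar R}.
Variables (k p : T -> T -> \bar R) (lam : R).
Hypothesis hk : kernel_fun k.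
Hypothesis hp : kernel_fun p.
Hypothesis lam0 : (0 < lam)%R.
Local Notation K := (kop m k).
Local Notation P := (kop m p).

(** The resolvent equation for [P = lam (lam + L)^-1], where [K] is the inverse
    of an operator [L]. *)
Hypothesis resolvent : forall f z, measurable_fun setT f ->
  (forall y, 0 <= f y) -> lam%:E * K f z = P f z + lam%:E * K (P f) z.
Hypothesis markov : forall z, P (cst 1) z <= 1.

Variables (W : T -> R) (F : T -> \bar R) (th : R).
Hypothesis th01 : (0 < th <= 1)%R.
Hypothesis mW : measurable_fun setT W.
Hypothesis W0 : forall z, (0 <= W z)%R.
Hypothesis mF : measurable_fun setT F.
Hypothesis F0 : forall z, 0 <= F z.

Let Wth z : \bar R := (W z `^ th)%:E.
Let src z : \bar R := (W z `^ (th - 1))%:E * P F z.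
Let supersol z :=
  (0 < W z)%R /\ P (EFin \o W) z + lam^-1%:E * P F z <= (W z)%:E.

Let mWth : measurable_fun setT Wth.
Proof.
apply/measurable_EFinP.
exact: (measurableT_comp (measurable_powR th) mW).
Qed.

Let Wth0 z : 0 <= Wth z. Proof. by rewrite lee_fin powR_ge0. Qed.

Let msrc : measurable_fun setT src.
Proof.
apply: emeasurable_funM; last exact: measurable_kop.
apply/measurable_EFinP.
exact: (measurableT_comp (measurable_powR (th - 1)) mW).
Qed.

Let src0 z : 0 <= src z.
Proof. by rewrite mule_ge0 ?lee_fin ?powR_ge0// kop_ge0. Qed.

(** Discrete chain rule: [P] being sub-Markovian, Jensen's inequality in the
    form of the tangent at [W z] bounds [P (W `^ th)]. *)
Lemma kop_powR_le z : supersol z ->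
  P Wth z + (th / lam)%:E * src z <= Wth z.
Proof.
move=> [Wz0 hz]; have /andP[th0 th1] := th01.
set a := W z in Wz0 hz *.
have c0 : (0 <= th * a `^ (th - 1))%R by rewrite mulr_ge0 ?powR_ge0// ltW.
have c1 : (0 <= (1 - th) * a `^ th)%R by rewrite mulr_ge0 ?powR_ge0// subr_ge0.
have h1 : P Wth z <= ((1 - th) * a `^ th)%:E +
    (th * a `^ (th - 1))%:E * P (EFin \o W) z.
  have mEW : measurable_fun setT (EFin \o W) by exact/measurable_EFinP.
  have : P Wth z <= P (fun y => ((1 - th) * a `^ th)%:E * cst 1 y +
      (th * a `^ (th - 1))%:E * (EFin \o W) y) z.
    apply: kop_le => //.
    - apply: emeasurable_funD; apply: emeasurable_funM => //.
    - by move=> y _ /=; rewrite mule1 -EFinM -EFinD lee_fin; exact: powR_le_tangent.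
  rewrite kopD//; last 3 first.
  - exact: emeasurable_funM.
  - by move=> y; rewrite mule_ge0.
  - by move=> y; rewrite mule_ge0 ?lee_fin//= ?lee_fin.
  rewrite !kopZ//.
  move=> /le_trans; apply; apply: leeD => //.
  by rewrite -[leRHS]mule1; apply: lee_wpmul2l; rewrite ?lee_fin.
apply: (le_trans (leeD h1 (lexx _))).
rewrite /src -/a -addeA muleA -EFinM.
have -> : (th / lam * a `^ (th - 1) = th * a `^ (th - 1) * lam^-1)%R by ring.
rewrite (EFinM _ lam^-1) -muleA -ge0_muleDr; last 2 first.
- by apply: kop_ge0 => // y; rewrite lee_fin.
- by rewrite mule_ge0 ?lee_fin ?invr_ge0 ?(ltW lam0)// kop_ge0.
have : (th * a `^ (th - 1))%:E * (P (EFin \o W) z + lam^-1%:E * P F z) <=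
    (th * a `^ (th - 1))%:E * a%:E by apply: lee_wpmul2l; rewrite ?lee_fin.
move=> /(leeD (lexx ((1 - th) * a `^ th)%:E)) /le_trans; apply.
rewrite -EFinM -EFinD lee_fin -mulrA (mulrC _ a) mulr_powRB1 ?(ltW Wz0)//.
by rewrite -mulrDl subrK mul1r.
Qed.

(** If [L W >= F], then [L (W `^ th) >= th W `^ (th - 1) F]: the previous
    inequality is [L_lam (W `^ th) >= th W `^ (th - 1) P F] for the bounded
    approximation [L_lam = lam (1 - P)] of [L]; applying [K] and
    [K L_lam = P] gives the claim, with [P F] in place of [F]. *)
Lemma kop_concave_power z0 : supersol z0 ->
  (forall z, 0 < k z0 z -> supersol z) -> K Wth z0 < +oo ->
  th%:E * K src z0 <= Wth z0.
Proof.
move=> sz0 sz Kfin; have /andP[th0 th1] := th01.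
have mP : measurable_fun setT (P Wth) by exact: measurable_kop.
have P0 z : 0 <= P Wth z by exact: kop_ge0.
have PWth : P Wth z0 <= Wth z0.
  apply: le_trans (kop_powR_le sz0); rewrite leeDl// mule_ge0//.
  by rewrite lee_fin divr_ge0// ltW.
have c0 : (0 <= th / lam)%R by rewrite divr_ge0// ltW.
have h : K (P Wth) z0 + (th / lam)%:E * K src z0 <= K Wth z0.
  rewrite -kopZ// -kopD//; last 2 first.
  - exact: emeasurable_funM.
  - by move=> y; rewrite mule_ge0.
  apply: kop_le => //.
  - by apply: emeasurable_funD => //; exact: emeasurable_funM.
  - by move=> y; rewrite adde_ge0// mule_ge0.
  - by move=> y /sz; exact: kop_powR_le.
have KPfin : K (P Wth) z0 \is a fin_num.
  rewrite ge0_fin_numE; last exact: kop_ge0.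
  apply: le_lt_trans Kfin; apply: le_trans h; rewrite leeDl// mule_ge0//.
  exact: kop_ge0.
apply: le_trans PWth.
have : lam%:E * (K (P Wth) z0 + (th / lam)%:E * K src z0) <= lam%:E * K Wth z0.
  by apply: lee_wpmul2l => //; rewrite lee_fin ltW.
rewrite resolvent// ge0_muleDr; last 2 first.
- exact: kop_ge0.
- by rewrite mule_ge0// kop_ge0.
rewrite muleA -EFinM mulrC divfK ?gt_eqF// addeC leeD2rE//.
by rewrite fin_numM.
Qed.

End concave_potential.

(** * Monotone iteration below a supersolution *)

Section monotone_iteration.
Context {R : realType}.

(** The power need not be differentiable at [l = 0], but the sequence is then
    constant. *)
Lemma cvg_powR_below (e : R) (u : R^nat) (l : R) : 0 <= e ->
  (forall n, 0 <= u n <= l) -> u n @[n --> \oo] --> l ->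
  u n `^ e @[n --> \oo] --> l `^ e.
Proof.
move=> e0 ul cul; have l0 : 0 <= l.
  by have /andP[/le_trans] := ul 0%N; apply.
have [lE|lN] := eqVneq l 0.
  suff -> : (fun n => u n `^ e) = cst (l `^ e) by exact: cvg_cst.
  apply/funext => n /=; congr (_ `^ _); apply/eqP.
  by rewrite lE eq_le -{1}lE andbC; exact: ul.
have lgt0 : 0 < l by rewrite lt_neqAle eq_sym lN.
have /derivable1_diffP/differentiable_continuous :
    derivable (fun x : R => x `^ e) l 1.
  by apply: derivable_powR; rewrite in_itv/= lgt0.
by move=> cl; apply: (@continuous_cvg _ R R _ _ u (fun x : R => x `^ e) l cl cul).
Qed.

Local Open Scope ereal_scope.
Context d (T : measurableType d).
Variables (m : {sigma_finite_measure set T -> \bar R}) (k : T -> T -> \bar R).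
Hypothesis hk : kernel_fun k.
Hypothesis kfin : forall x y, k x y \is a fin_num.
Local Notation K := (kop m k).

(* The two unknowns are indexed by [bool], so that both equations are treated
   at once: component [b] has source [u (~~ b) `^ e b]. *)
Variables (e : bool -> R) (phi : bool -> T -> \bar R) (U : bool -> T -> R).
Hypothesis e0 : forall b, (0 <= e b)%R.
Hypothesis mphi : forall b, measurable_fun setT (phi b).
Hypothesis phi0 : forall b z, 0 <= phi b z.
Hypothesis mU : forall b, measurable_fun setT (U b).
Let source (u : bool -> T -> R) b (z : T) : \bar R := (u (~~ b) z `^ e b)%:E.
Hypothesis supersol : forall b z, phi b z + K (source U b) z <= (U b z)%:E.

Let step (u : bool -> T -> R) b z : R := fine (phi b z + K (source u b) z).

Let msource (u : bool -> T -> R) b : (forall b, measurable_fun setT (u b)) ->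
  measurable_fun setT (source u b).
Proof.
move=> mu; apply/measurable_EFinP.
exact: (measurableT_comp (measurable_powR (e b)) (mu (~~ b))).
Qed.

Let source0 u b z : 0 <= source u b z. Proof. by rewrite lee_fin powR_ge0. Qed.

Let source_le (u v : bool -> T -> R) b x : (forall b, measurable_fun setT (u b)) ->
  (forall b, measurable_fun setT (v b)) ->
  (forall b z, 0 <= u b z)%R -> (forall b z, u b z <= v b z)%R ->
  K (source u b) x <= K (source v b) x.
Proof.
move=> mu mv u0 uv; apply: kop_le => //; [exact: msource|exact: msource|].
by move=> y _; rewrite lee_fin ge0_ler_powR ?nnegrE// (le_trans _ (uv _ _)).
Qed.

Let U0 b z : (0 <= U b z)%R.
Proof.
rewrite -lee_fin; apply: le_trans (supersol b z).
by rewrite adde_ge0// kop_ge0.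
Qed.

Let mstep (u : bool -> T -> R) b : (forall b, measurable_fun setT (u b)) ->
  measurable_fun setT (step u b).
Proof.
move=> mu.
have mg : measurable_fun setT (fun z => phi b z + K (source u b) z).
  by apply: emeasurable_funD => //; apply: measurable_kop => //; exact: msource.
exact: measurable_fine_comp mg.
Qed.

Let stepE (u : bool -> T -> R) b z : (forall b, measurable_fun setT (u b)) ->
  (forall b z, 0 <= u b z)%R -> (forall b z, u b z <= U b z)%R ->
  (step u b z)%:E = phi b z + K (source u b) z /\ (step u b z <= U b z)%R.
Proof.
move=> mu u0 uU.
have sU : phi b z + K (source u b) z <= (U b z)%:E.
  by apply: le_trans (supersol b z); apply: leeD2l; exact: source_le.
have E : (step u b z)%:E = phi b z + K (source u b) z.
  have s0 : 0 <= phi b z + K (source u b) z by apply: adde_ge0; [|apply: kop_ge0].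
  apply: fineK; rewrite ge0_fin_numE; last exact: s0.
  exact: le_lt_trans sU (ltry (U b z)).
by split => //; rewrite -lee_fin E.
Qed.

Lemma monotone_iteration : exists u : bool -> T -> R,
  [/\ forall b, measurable_fun setT (u b), forall b z, (0 <= u b z)%R,
      forall b z, (u b z <= U b z)%R &
      forall b z, (u b z)%:E = phi b z +
        K (fun y => (u (~~ b) y `^ e b)%:E) z].
Proof.
pose u_ n : bool -> T -> R := iter n step (fun _ _ => 0%R).
have u_0E : u_ 0%N = (fun _ _ => 0%R) by [].
have u_SE n : u_ n.+1 = step (u_ n) by [].
clearbody u_.
have u_P n : [/\ forall b, measurable_fun setT (u_ n b),
    forall b z, (0 <= u_ n b z)%R & forall b z, (u_ n b z <= U b z)%R].
  elim: n => [|n [mu u0 uU]].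
    by rewrite u_0E; split=> // b; exact: measurable_cst.
  rewrite u_SE; split=> [b|b z|b z]; first exact: mstep.
    by rewrite /step fine_ge0// adde_ge0// kop_ge0.
  by have [] := stepE b z mu u0 uU.
have u_S n b z : (u_ n.+1 b z)%:E = phi b z + K (source (u_ n) b) z.
  by have [mu u0 uU] := u_P n; rewrite u_SE; have [] := stepE b z mu u0 uU.
have u_nd b z : nondecreasing_seq (fun n => u_ n b z).
  apply/nondecreasing_seqP => n; elim: n b z => [|n IH] b z.
    by rewrite {1}u_0E; have [_ u0 _] := u_P 1%N; exact: u0.
  have [mu u0 _] := u_P n; have [mu' _ _] := u_P n.+1.
  rewrite -lee_fin u_S u_S; apply: leeD2l.
  exact: (@source_le (u_ n) (u_ n.+1) b z mu mu' u0 IH).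
have cu b z : cvgn (fun n => u_ n b z).
  apply: nondecreasing_is_cvgn; first exact: u_nd.
  by exists (U b z) => _ [n _ <-]; have [_ _] := u_P n; exact.
pose u b z := limn (fun n => u_ n b z).
have u_le n b z : (0 <= u_ n b z <= u b z)%R.
  have [_ -> _] := u_P n; rewrite /=.
  exact: (nondecreasing_cvgn_le (u_nd b z)).
exists u; split.
- move=> b; apply: (@measurable_fun_cvg _ _ _ _ (fun n => u_ n b)) => [n|z _].
    by have [] := u_P n.
  exact: cu.
- by move=> b z; have /andP[/le_trans] := u_le 0%N b z; apply.
- move=> b z; apply: limr_le; first exact: cu.
  by apply: nearW => n; have [_ _] := u_P n; exact.
move=> b z.
have cl : (u_ n.+1 b z)%:E @[n --> \oo] --> (u b z)%:E.
  apply: cvg_EFin; first exact: nearW.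
  by rewrite (@cvg_shiftS _ (fun n => u_ n b z)); exact: cu.
rewrite -(cvg_lim (@ereal_hausdorff R) cl).
apply: (cvg_lim (@ereal_hausdorff R)).
under eq_fun => n do rewrite (u_S n b z).
have csrc y : source (u_ n) b y @[n --> \oo] --> source u b y.
  apply: cvg_EFin; first exact: nearW.
  by apply: cvg_powR_below => //; exact: cu.
apply: cvgeD; [|exact: cvg_cst|].
  by rewrite ge0_adde_def ?inE ?kop_ge0// => y; rewrite lee_fin powR_ge0.
have -> : K (fun y => (u (~~ b) y `^ e b)%:E) z =
    \int[m]_y limn (fun n => k z y * source (u_ n) b y).
  apply: eq_integral => y _; apply/esym/cvg_lim => //.
  by apply: cvgeZl.
apply: cvg_monotone_convergence => //.
- move=> n; apply: emeasurable_funM; first exact: measurable_kernel_section.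
  by apply: msource; have [] := u_P n.
- by move=> n y _; have [k0 _] := hk; rewrite mule_ge0.
- move=> y _ n n' nn'; have [k0 _] := hk.
  apply: lee_wpmul2l => //; rewrite lee_fin ge0_ler_powR// ?nnegrE.
  + by have [_ ->] := u_P n.
  + by have [_ ->] := u_P n'.
  + exact: u_nd.
Qed.

End monotone_iteration.

(** * Borel measurability *)

Lemma open_setX (T1 T2 : topologicalType) (A : set T1) (B : set T2) :
  open A -> open B -> open (A `*` B).
Proof.
move=> oA oB; rewrite openE => -[x y] [/= Ax By].
by exists (A, B) => //; split; exact: open_nbhs_nbhs.
Qed.

Section countable_base.
Context {R : realType}.

(** The Borel sets of a product of second countable spaces are generated by
    the boxes; a countable base made of sets of the product sigma-algebra
    witnesses this and is stable under products. *)
Definition countable_base (T : pseudoMetricType R) (M : set (set T)) : Prop :=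
  exists (I : countType) (B : I -> set T), (forall i, M (B i)) /\
    forall x (e : R), 0 < e -> exists2 i, B i x & B i `<=` ball x e.

Lemma open_countable_base (T : pseudoMetricType R) (M : set (set T)) (U : set T) :
  (forall (I : countType) (F : I -> set T), (forall i, M (F i)) ->
    M (\bigcup_i F i)) -> M set0 ->
  countable_base M -> open U -> M U.
Proof.
move=> Mbig M0 [I [B [MB Bball]]] oU.
have -> : U = \bigcup_i (if `[< B i `<=` U >] then B i else set0).
  apply/seteqP; split=> [x Ux|x [i _]]; last by case: asboolP => // /[apply].
  have /nbhs_ballP[e /= e0 eU] := open_nbhs_nbhs (conj oU Ux).
  have [i Bix Bie] := Bball x e e0; exists i => //.
  by case: asboolP => // -[]; exact: subset_trans eU.
by apply: Mbig => i; case: ifP.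
Qed.

Lemma countable_base_R :
  @countable_base R (@measurable _ (measurableTypeR R)).
Proof.
exists (rat * rat)%type, (fun q => `]ratr q.1, ratr q.2[%classic).
split=> [q|x e e0]; first exact: measurable_itv.
have [q1 q1x] : exists q : rat, ratr q \in `]x - e, x[%R.
  by apply: rat_in_itvoo; rewrite ltrBlDr ltrDl.
have [q2 q2x] : exists q : rat, ratr q \in `]x, x + e[%R.
  by apply: rat_in_itvoo; rewrite ltrDl.
move: q1x q2x; rewrite !in_itv/= => /andP[a b] /andP[c f].
exists (q1, q2) => /=; first by rewrite in_itv/= b c.
move=> y /=; rewrite in_itv/= => /andP[g h].
rewrite /ball/= ltr_distlC; apply/andP.
by split; [exact: lt_trans g|exact: lt_trans f].
Qed.

Lemma countable_base_rV n :
  @countable_base 'rV[R]_n (@measurable _ 'rV[R]_n).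
Proof.
have [I [B [MB Bball]]] := countable_base_R.
exists {ffun 'I_n -> I}, (fun f : {ffun 'I_n -> I} => \bigcap_(i in [set: 'I_n])
  ((fun x : 'rV[R]_n => x ord0 i : measurableTypeR R) @^-1` B (f i))).
split=> [f|x e e0].
  apply: fin_bigcap_measurable => [|i _]; first exact: finite_finset.
  by rewrite -[X in measurable X]setTI; exact: measurable_rV_coord.
have /choice[f Hf] : forall i : 'I_n, exists j, B j (x ord0 i) /\
    B j `<=` ball (x ord0 i) e.
  by move=> i; have [j ? ?] := Bball (x ord0 i) e e0; exists j.
exists (finfun f) => [i _ /=|y Hy]; first by rewrite ffunE; exact: (Hf i).1.
split=> // i j; rewrite (ord1 i); apply: (Hf j).2.
by have := Hy j Logic.I; rewrite /= ffunE.
Qed.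

Lemma countable_base_prod (T1 T2 : pseudoMetricType R) (M1 : set (set T1))
    (M2 : set (set T2)) (M : set (set (T1 * T2))) :
  (forall A B, M1 A -> M2 B -> M (A `*` B)) ->
  countable_base M1 -> countable_base M2 -> countable_base M.
Proof.
move=> M12 [I [A [MA Aball]]] [J [B [MB Bball]]].
exists (I * J)%type, (fun ij => A ij.1 `*` B ij.2); split=> [ij|[x y] e e0].
  exact: M12.
have [i Ax Ae] := Aball x e e0; have [j By Be] := Bball y e e0.
by exists (i, j) => // -[x' y'] [/Ae ? /Be ?].
Qed.

Lemma open_measurable_rV n (U : set 'rV[R]_n) : open U -> measurable U.
Proof.
apply: open_countable_base => //; last exact: countable_base_rV.
by move=> I F mF; apply: countable_bigcupT_measurable.
Qed.

Lemma open_measurable_R_rV_rV n (U : set (R * ('rV[R]_n * 'rV[R]_n))) :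
  open U -> @measurable _ (measurableTypeR R * ('rV[R]_n * 'rV[R]_n))%type U.
Proof.
apply: open_countable_base => //.
- by move=> I F mF; apply: countable_bigcupT_measurable.
apply: (countable_base_prod (M1 := @measurable _ (measurableTypeR R))
  (M2 := @measurable _ ('rV[R]_n * 'rV[R]_n)%type)).
- by move=> A B mA mB; exact: measurableX.
- exact: countable_base_R.
apply: (countable_base_prod (M1 := @measurable _ 'rV[R]_n)
  (M2 := @measurable _ 'rV[R]_n)).
- by move=> A B mA mB; exact: measurableX.
- exact: countable_base_rV.
- exact: countable_base_rV.
Qed.

End countable_base.

(** * The Dirichlet heat kernel as a kernel on space-time *)

Section product_sigma_finite.
Local Open Scope ereal_scope.
Context d1 d2 (T1 : measurableType d1) (T2 : measurableType d2) {R : realType}.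
Variable m1 : {sigma_finite_measure set T1 -> \bar R}.
Variable m2 : {sigma_finite_measure set T2 -> \bar R}.

(** The product measure under a name of its own, so that its sigma-finiteness
    is found by unification rather than that of a product of probabilities. *)
Definition product_measure : set (T1 * T2) -> \bar R := m1 \x m2.

HB.instance Definition _ := Measure.copy product_measure (m1 \x m2).

Let product_measure_sigma_finite : sigma_finite setT product_measure.
Proof.
have /sigma_finiteP[F [UF ndF Foo]] := sigma_finiteT m1.
have /sigma_finiteP[G [UG ndG Goo]] := sigma_finiteT m2.
exists (fun k => F k `*` G k).
  apply/esym/seteqP; split => // -[x y] _.
  have [i _ Fi] : (\bigcup_i F i) x by rewrite -UF.
  have [j _ Gj] : (\bigcup_j G j) y by rewrite -UG.
  exists (maxn i j) => //; split.
  - by move: Fi; exact/subsetPset/ndF/leq_maxl.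
  - by move: Gj; exact/subsetPset/ndG/leq_maxr.
move=> k; have [mFk Fk] := Foo k; have [mGk Gk] := Goo k; split.
  exact: measurableX.
by rewrite /product_measure product_measure1E// lte_mul_pinfty// ge0_fin_numE.
Qed.

HB.instance Definition _ := Measure_isSigmaFinite.Build _ _ _ product_measure
  product_measure_sigma_finite.

End product_sigma_finite.

Section exponential_integrals.
Context {R : realType}.
Local Notation mu := (@lebesgue_measure R).

Let exp_FTC (a b c s t : R) : s < t ->
  (\int[mu]_(r in `]s, t[) (a * c * expR (c * (r - b)))%:E =
    (a * expR (c * (t - b)) - a * expR (c * (s - b)))%:E)%E.
Proof.
move=> st.
pose F (r : R) : R := a * expR (c * (r - b)).
have dF (x : R) : is_derive x (1 : R) F (a * c * expR (c * (x - b))).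
  rewrite /F; apply: is_derive_eq.
  by rewrite /GRing.scale/=; ring.
have cf : continuous (fun r : R => a * c * expR (c * (r - b))).
  move=> x; apply: cvgM; first exact: cvg_cst.
  apply: (@continuous_comp R R R (fun r => c * (r - b)) expR).
    by apply: cvgM; [exact: cvg_cst|apply: cvgB; [exact: cvg_id|exact: cvg_cst]].
  exact: continuous_expR.
have cF : continuous F.
  move=> x; apply/differentiable_continuous/derivable1_diffP.
  exact: ex_derive.
rewrite -(@integral_itv_bndoo R s t _ true false); last first.
  apply/measurable_EFinP; apply: measurable_funTS.
  exact: continuous_measurable_fun.
rewrite (@continuous_FTC2 R _ F)//.
- exact: continuous_subspaceT.
- split.
  + by move=> x _; exact: ex_derive.
  + by apply: cvg_at_right_filter; exact: cF.
  + by apply: cvg_at_left_filter; exact: cF.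
- by move=> x _; rewrite derive1E; exact: derive_val.
Qed.

Lemma integral_expR_final (lam s t : R) : s < t ->
  (\int[mu]_(r in `]s, t[) (lam * expR (- lam * (t - r)))%:E =
    (1 - expR (- lam * (t - s)))%:E)%E.
Proof.
move=> st; have := exp_FTC 1 t lam st; rewrite subrr mulr0 expR0 !mul1r.
rewrite (_ : lam * (s - t) = - lam * (t - s)); last by ring.
move=> <-; apply: eq_integral => r _; congr (_ * expR _)%:E; ring.
Qed.

Lemma integral_expR_initial (lam s t : R) : s < t ->
  (\int[mu]_(r in `]s, t[) (lam * expR (- lam * (r - s)))%:E =
    (1 - expR (- lam * (t - s)))%:E)%E.
Proof.
move=> st; have := exp_FTC (-1) s (- lam) st.
rewrite subrr mulr0 expR0.
rewrite (_ : -1 * expR (- lam * (t - s)) - -1 * 1 = 1 - expR (- lam * (t - s)));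
  last by ring.
move=> <-; apply: eq_integral => r _; congr (_ * expR _)%:E; ring.
Qed.

End exponential_integrals.

Section heat_kernel.
Context {R : realType} {N : nat}.
Local Notation V := 'rV[R]_N.
Local Notation RR := (measurableTypeR R).
Local Notation Z := (V * RR)%type.
Local Notation leb := (@lebesgue_rV R N).
Local Notation mu := (@lebesgue_measure R).
Variables (Omega : set V) (G : R -> V -> V -> R).
Hypothesis oOmega : open Omega.
Hypothesis hG : dirichlet_heat_kernel Omega G.

Local Notation mZ := (product_measure leb mu).

Let Q : set (R * (V * V)) := halfline `*` (Omega `*` Omega).

(** Extension of the heat kernel by zero, which makes it a measurable function
    on the whole of [RR * (V * V)]. *)
Definition heat0 (t : R) (x y : V) : R :=
  ((fun z : R * (V * V) => G z.1 z.2.1 z.2.2) \_ Q) (t, (x, y)).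

Lemma heat0E t x y : 0 < t -> Omega x -> Omega y -> heat0 t x y = G t x y.
Proof.
move=> t0 Ox Oy; rewrite /heat0 patchE ifT// inE; split=> //=.
by rewrite /halfline/= in_itv/= t0.
Qed.

Lemma heat0_eq0 t x y : ~ (0 < t /\ Omega x /\ Omega y) -> heat0 t x y = 0.
Proof.
move=> h; rewrite /heat0 patchE ifF//; apply/negbTE; rewrite notin_setE.
by move=> -[/=]; rewrite /halfline/= in_itv/= andbT => t0 [Ox Oy]; apply: h.
Qed.

Lemma heat0_ge0 t x y : 0 <= heat0 t x y.
Proof.
have [[t0 [Ox Oy]]|h] := pselect (0 < t /\ Omega x /\ Omega y).
  by rewrite heat0E// ltW// (dhk_gt0 hG).
by rewrite heat0_eq0.
Qed.

Lemma heat0_gt0P t x y : 0 < heat0 t x y -> [/\ 0 < t, Omega x & Omega y].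
Proof.
have [[t0 [Ox Oy]] //|h] := pselect (0 < t /\ Omega x /\ Omega y).
by rewrite heat0_eq0// ltxx.
Qed.

Lemma measurable_Omega : measurable Omega. Proof. exact: open_measurable_rV. Qed.

Lemma measurable_heat0 :
  measurable_fun setT (fun z : RR * (V * V) => heat0 z.1 z.2.1 z.2.2).
Proof.
have oQ : open Q.
  by apply: open_setX; [exact: itv_open_ends_open|exact: open_setX].
have mQ : @measurable _ (RR * (V * V))%type Q by exact: open_measurable_R_rV_rV.
rewrite (_ : (fun z => _) =
    (fun z : RR * (V * V) => G z.1 z.2.1 z.2.2) \_ Q); last first.
  by apply/funext => -[t [x y]].
apply/(measurable_restrict _ mQ measurableT).
rewrite setTI.
apply: (measurability _ (RGenOInfty.measurableE R)) => _ [_ [a ->] <-].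
apply: open_measurable_R_rV_rV; rewrite openE => z [Qz /= az].
have := dhk_continuous hG; rewrite continuous_open_subspace// => /(_ z).
rewrite inE => /(_ Qz) cG.
have : nbhs z Q by apply: open_nbhs_nbhs.
have : \forall w \near z, a < G w.1 w.2.1 w.2.2.
  by apply: (cvgr_gt _ cG); move: az; rewrite in_itv/= andbT.
rewrite /interior; apply: filterS2 => w /= aw Qw; split=> //.
by rewrite in_itv/= aw.
Qed.

Lemma heat0_le1 t x : (\int[leb]_y (heat0 t x y)%:E <= 1)%E.
Proof.
have [[t0 Ox]|h] := pselect (0 < t /\ Omega x).
  rewrite (_ : (\int[leb]_y _)%E = (\int[leb]_(y in Omega) (G t x y)%:E)%E).
    exact: (dhk_le1 hG).
  rewrite [RHS]integral_mkcond; apply: eq_integral => y _; rewrite patchE.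
  case: ifPn; first by rewrite inE => Oy; rewrite heat0E.
  by rewrite notin_setE => Oy; rewrite heat0_eq0// => -[_ [_ /Oy]].
rewrite integral0_eq// => y _; rewrite heat0_eq0// => -[? [? _]].
exact: h.
Qed.

Lemma heat0_semigroup s t x y : 0 < s -> 0 < t ->
  (\int[leb]_z (heat0 s x z * heat0 t z y)%:E = (heat0 (s + t) x y)%:E)%E.
Proof.
move=> s0 t0.
have [[Ox Oy]|h] := pselect (Omega x /\ Omega y).
  rewrite heat0E ?addr_gt0// -(dhk_semigroup hG)// [RHS]integral_mkcond.
  apply: eq_integral => z _; rewrite patchE; case: ifPn.
    by rewrite inE => Oz; rewrite !heat0E.
  by rewrite notin_setE => Oz; rewrite heat0_eq0 ?mul0r// => -[_ [_ /Oz]].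
rewrite heat0_eq0; last by move=> [_ ?]; exact: h.
rewrite integral0_eq// => z _.
have [Ox|Ox] := pselect (Omega x); last first.
  by rewrite heat0_eq0 ?mul0r// => -[_ [/Ox]].
rewrite (@heat0_eq0 t z y) ?mulr0// => -[_ [_ Oy]]; exact: h.
Qed.

(** The Dirichlet heat semigroup as an operator from data to functions on
    space-time. *)
Definition skernel (z : Z) (y : V) : \bar R := (heat0 z.2 z.1 y)%:E.

(** Space-time kernels [rho (t - s) G (t - s) x y] for [0 < s < t]: the weight
    [1] gives the Duhamel operator, i.e. the inverse of the heat operator, and
    [lam * expR (- lam * t)] gives [lam] times its resolvent. *)
Definition wkernel (rho : R -> R) (z w : Z) : \bar R :=
  (rho (z.2 - w.2) * (\1_(`]0, +oo[%classic : set RR) w.2 *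
    heat0 (z.2 - w.2) z.1 w.1))%:E.

Definition duhamel_kernel : Z -> Z -> \bar R := wkernel (fun=> 1).

Definition resolvent_kernel (lam : R) : Z -> Z -> \bar R :=
  wkernel (fun t => lam * expR (- lam * t)).

Lemma skernel_kernel : kernel_fun skernel.
Proof.
split=> [z y|]; first by rewrite lee_fin heat0_ge0.
apply/measurable_EFinP.
have mg : measurable_fun setT (fun w : Z * V => (w.1.2, (w.1.1, w.2))).
  apply: measurable_fun_pair; first exact: measurableT_comp.
  by apply: measurable_fun_pair => //; exact: measurableT_comp.
exact: (measurableT_comp measurable_heat0 mg).
Qed.

Lemma wkernel_kernel (rho : R -> R) :
  measurable_fun setT rho -> (forall t, 0 <= rho t) ->
  kernel_fun (wkernel rho).
Proof.
move=> mrho rho0; split=> [z w|].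
  by rewrite lee_fin !mulr_ge0// heat0_ge0.
apply/measurable_EFinP.
have m12 : measurable_fun setT (fun w : Z * Z => w.1.2 : R).
  exact: (measurableT_comp measurable_snd measurable_fst).
have m22 : measurable_fun setT (fun w : Z * Z => w.2.2 : R).
  exact: (measurableT_comp measurable_snd measurable_snd).
have msub : measurable_fun setT (fun w : Z * Z => w.1.2 - w.2.2 : R).
  exact: measurable_funB.
apply: measurable_funM; first exact: (measurableT_comp mrho msub).
apply: measurable_funM.
  have m1 : measurable_fun setT (\1_(`]0, +oo[%classic : set R) : R -> R).
    by apply: measurable_indic; exact: measurable_itv.
  exact: (measurableT_comp m1 m22).
have mg : measurable_fun setT
    (fun w : Z * Z => (w.1.2 - w.2.2 : RR, (w.1.1, w.2.1))).
  apply: measurable_fun_pair => //.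
  by apply: measurable_fun_pair; exact: measurableT_comp.
exact: (measurableT_comp measurable_heat0 mg).
Qed.

End heat_kernel.

Section heat_kernel_algebra.
Local Open Scope ereal_scope.
Context {R : realType} {N : nat}.
Local Notation V := 'rV[R]_N.
Local Notation RR := (measurableTypeR R).
Local Notation Z := (V * RR)%type.
Local Notation leb := (@lebesgue_rV R N).
Local Notation mu := (@lebesgue_measure R).
Local Notation mZ := (product_measure leb mu).
Variables (Omega : set V) (G : R -> V -> V -> R).
Hypothesis oOmega : open Omega.
Hypothesis hG : dirichlet_heat_kernel Omega G.
Local Notation g := (heat0 Omega G).
Local Notation wk := (wkernel Omega G).
Local Notation K := (kop mZ (duhamel_kernel Omega G)).
Local Notation P lam := (kop mZ (resolvent_kernel Omega G lam)).
Local Notation S := (kop leb (skernel Omega G)).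

Lemma integral_spacetime (f : Z -> \bar R) : measurable_fun setT f ->
  (forall w, 0 <= f w) ->
  \int[mZ]_w f w = \int[mu]_r \int[leb]_x f (x, r).
Proof. by move=> mf f0; exact: fubini_tonelli2. Qed.

(** The Chapman-Kolmogorov identity in the space variable leaves the
    convolution of the time weights. *)
Lemma wkernel_comp (rho sigma : R -> R) (s : R) (z : Z) (y : V) :
  measurable_fun setT rho -> measurable_fun setT sigma ->
  (forall t, 0 <= rho t)%R -> (forall t, 0 <= sigma t)%R -> (0 <= s)%R ->
  \int[mZ]_w (wk rho z w * (sigma (w.2 - s) * g (w.2 - s) w.1 y)%:E) =
  (g (z.2 - s) z.1 y)%:E *
    \int[mu]_(r in `]s, z.2[) (rho (z.2 - r) * sigma (r - s))%:E.
Proof.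
move=> mrho msigma rho0 sigma0 s0.
have msub : measurable_fun setT (fun w : Z => w.2 - s : R)%R.
  by apply: measurable_funB => //; exact: measurable_snd.
have msg : measurable_fun setT
    (fun w : Z => (sigma (w.2 - s) * g (w.2 - s) w.1 y)%:E).
  apply/measurable_EFinP; apply: measurable_funM.
    exact: (measurableT_comp msigma msub).
  have mg : measurable_fun setT (fun w : Z => (w.2 - s : RR, (w.1, y)))%R.
    apply: measurable_fun_pair => //.
    by apply: measurable_fun_pair => //; exact: measurable_fst.
  exact: (measurableT_comp (measurable_heat0 oOmega hG) mg).
have hk := wkernel_kernel oOmega hG mrho rho0.
rewrite integral_spacetime; last 2 first.
- by apply: emeasurable_funM => //; exact: measurable_kernel_section.
- move=> w; rewrite mule_ge0 ?(hk.1)// lee_fin mulr_ge0// heat0_ge0//.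
rewrite (_ : (fun r => _) = (fun r => (g (z.2 - s) z.1 y)%:E *
    (rho (z.2 - r) * sigma (r - s))%:E) \_ `]s, z.2[%classic); last first.
  apply/funext => r; rewrite patchE /wkernel /=.
  case: ifPn => [|].
    rewrite inE/= in_itv/= => /andP[sr rz].
    have r0 : (0 < r)%R by exact: le_lt_trans sr.
    transitivity (\int[leb]_x ((rho (z.2 - r) * sigma (r - s))%:E *
        (g (z.2 - r) z.1 x * g (r - s) x y)%:E)).
      apply: eq_integral => x _; rewrite indicE mem_set/=; last first.
        by rewrite in_itv/= r0.
      by rewrite mul1r -!EFinM mulrACA.
    rewrite ge0_integralZl//; last 3 first.
    - apply/measurable_EFinP; apply: measurable_funM.
        have mg : measurable_fun setT (fun x : V => (z.2 - r : RR, (z.1, x)))%R.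
          by apply: measurable_fun_pair => //; exact: measurable_fun_pair.
        exact: (measurableT_comp (measurable_heat0 oOmega hG) mg).
      have mg : measurable_fun setT (fun x : V => (r - s : RR, (x, y)))%R.
        by apply: measurable_fun_pair => //; exact: measurable_fun_pair.
      exact: (measurableT_comp (measurable_heat0 oOmega hG) mg).
    - by move=> x _; rewrite lee_fin mulr_ge0// heat0_ge0.
    - by rewrite lee_fin mulr_ge0.
    rewrite (heat0_semigroup hG) ?subr_gt0// muleC.
    by rewrite addrA subrK.
  rewrite notin_setE/= in_itv/= => /negP; rewrite negb_and -!leNgt => h.
  apply: integral0_eq => x _; case/orP: h => h.
    rewrite (@heat0_eq0 _ _ _ _ (r - s)%R) ?mulr0 ?mule0// => -[].
    by rewrite subr_gt0 ltNge h.
  rewrite (@heat0_eq0 _ _ _ _ (z.2 - r)%R) ?mulr0 ?mul0e// => -[].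
  by rewrite subr_gt0 ltNge h.
rewrite -integral_mkcond ge0_integralZl//.
- apply/measurable_EFinP/measurable_funTS; apply: measurable_funM.
    apply: (measurableT_comp mrho).
    by apply: measurable_funB.
  apply: (measurableT_comp msigma).
  by apply: measurable_funB.
- by move=> r _; rewrite lee_fin mulr_ge0.
- by rewrite lee_fin heat0_ge0.
Qed.

Let expw_ge0 (lam : R) : (0 <= lam)%R ->
  forall t, (0 <= lam * expR (- lam * t))%R.
Proof. by move=> l0 t; rewrite mulr_ge0// expR_ge0. Qed.

Let mexpw (lam : R) :
  measurable_fun setT (fun t : R => lam * expR (- lam * t))%R.
Proof.
apply: measurable_funM => //; apply: measurableT_comp; first exact: measurable_expR.
exact: measurable_funM.
Qed.

Lemma duhamel_kernel_kernel : kernel_fun (duhamel_kernel Omega G).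
Proof. by apply: wkernel_kernel => // t; exact: ler01. Qed.

Lemma resolvent_kernel_kernel lam : (0 <= lam)%R ->
  kernel_fun (resolvent_kernel Omega G lam).
Proof. by move=> l0; apply: wkernel_kernel => //; exact: expw_ge0. Qed.

(** The heat kernel has mass at most one in space, and the time weight is the
    density of an exponential law. *)
Lemma resolvent_kernel_le1 lam z : (0 < lam)%R -> P lam (cst 1) z <= 1.
Proof.
move=> l0; have hp := resolvent_kernel_kernel (ltW l0).
rewrite /kop integral_spacetime; last 2 first.
- by apply: emeasurable_funM => //; exact: measurable_kernel_section.
- by move=> w; rewrite mule_ge0// hp.1.
apply: (@le_trans _ _ (\int[mu]_(r in `]0%R, z.2[)
    (lam * expR (- lam * (z.2 - r)))%:E)).
  rewrite [leRHS]integral_mkcond; apply: ge0_le_integral => //.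
  - move=> r _; apply: integral_ge0 => x _.
    by rewrite mule_ge0// hp.1.
  - apply: (@measurable_fun_fubini_tonelli_G _ _ _ _ _ leb
      (fun w : Z => resolvent_kernel Omega G lam z w * cst 1 w)).
      by apply: emeasurable_funM => //; exact: measurable_kernel_section.
    by move=> w; rewrite mule_ge0// hp.1.
  - apply/(measurable_restrict _ _ _) => //; apply: measurable_funTS.
    apply/measurable_EFinP; apply: (measurableT_comp (mexpw lam)).
    exact: measurable_funB.
  move=> r _; rewrite patchE; case: ifPn.
    rewrite inE/= in_itv/= => /andP[r0 rz].
    under eq_integral do rewrite mule1 /resolvent_kernel /wkernel/= EFinM.
    rewrite ge0_integralZl//; last 3 first.
    - apply/measurable_EFinP; apply: measurable_funM => //.
      have mg : measurable_fun setT (fun x : V => (z.2 - r : RR, (z.1, x)))%R.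
        by apply: measurable_fun_pair => //; exact: measurable_fun_pair.
      exact: (measurableT_comp (measurable_heat0 oOmega hG) mg).
    - by move=> x _; rewrite lee_fin mulr_ge0// heat0_ge0.
    - by rewrite lee_fin expw_ge0// ltW.
    rewrite -[leRHS]mule1; apply: lee_wpmul2l.
      by rewrite lee_fin expw_ge0// ltW.
    under eq_integral => x _.
      rewrite indicE mem_set/=; last by rewrite in_itv/= r0.
      rewrite mul1r.
      over.
    exact: heat0_le1.
  rewrite notin_setE/= in_itv/= => /negP; rewrite negb_and -!leNgt => h.
  rewrite integral0_eq// => x _; rewrite /resolvent_kernel /wkernel/= mule1.
  case/orP: h => h.
    rewrite indicE memNset/= ?mul0r ?mulr0//.
    by rewrite in_itv/= andbT; apply/negP; rewrite -leNgt.
  rewrite heat0_eq0 ?mulr0// => -[].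
  by rewrite subr_gt0 ltNge h.
have [z0|z0] := ltP 0%R z.2; last first.
  by rewrite set_itv_ge ?integral_set0// bnd_simp -leNgt.
by rewrite integral_expR_final// lee_fin gerBl expR_ge0.
Qed.

Let int_final (lam s t : R) (x y : V) : (0 <= s)%R ->
  (g (t - s) x y)%:E *
    \int[mu]_(r in `]s, t[) (lam * expR (- lam * (t - r)))%:E =
  (g (t - s) x y * (1 - expR (- lam * (t - s))))%:E.
Proof.
move=> s0; have [st|ts] := ltP s t; first by rewrite integral_expR_final// -EFinM.
rewrite (@heat0_eq0 _ _ _ _ (t - s)%R) ?mul0e ?mul0r// => -[].
by rewrite subr_gt0 ltNge ts.
Qed.

Let int_initial (lam s t : R) (x y : V) : (0 <= s)%R ->
  (g (t - s) x y)%:E *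
    \int[mu]_(r in `]s, t[) (lam * expR (- lam * (r - s)))%:E =
  (g (t - s) x y * (1 - expR (- lam * (t - s))))%:E.
Proof.
move=> s0; have [st|ts] := ltP s t; first by rewrite integral_expR_initial// -EFinM.
rewrite (@heat0_eq0 _ _ _ _ (t - s)%R) ?mul0e ?mul0r// => -[].
by rewrite subr_gt0 ltNge ts.
Qed.

Let wk_initial rho (w : Z) : (0 < w.2)%R -> forall v,
  wk rho v w = (rho (v.2 - w.2) * g (v.2 - w.2) v.1 w.1)%:E.
Proof.
by move=> w0 v; rewrite /wkernel indicE mem_set ?mul1r//= in_itv/= w0.
Qed.

Let wk_eq0 rho (w : Z) : (w.2 <= 0)%R -> forall v, wk rho v w = 0.
Proof.
move=> w0 v; rewrite /wkernel indicE memNset ?mul0r ?mulr0//=.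
by rewrite in_itv/= andbT; apply/negP; rewrite -leNgt.
Qed.

Lemma duhamel_resolvent_kernel lam z w : (0 < lam)%R ->
  lam%:E * duhamel_kernel Omega G z w = resolvent_kernel Omega G lam z w +
    lam%:E * \int[mZ]_v (duhamel_kernel Omega G z v *
                         resolvent_kernel Omega G lam v w).
Proof.
move=> l0; have [w0|w0] := ltP 0%R w.2; last first.
  rewrite /duhamel_kernel /resolvent_kernel !wk_eq0// mule0 add0e.
  rewrite integral0_eq ?mule0// => v _.
  by rewrite (wk_eq0 _ w0) mule0.
under eq_integral do rewrite /resolvent_kernel wk_initial//.
have := @wkernel_comp (fun=> 1%R) (fun t => lam * expR (- lam * t))%R w.2 z w.1.
rewrite /duhamel_kernel => ->//; last 2 first.
- by apply: expw_ge0; exact: ltW.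
- exact: ltW.
under eq_integral do rewrite mul1r.
rewrite int_initial ?ltW// /resolvent_kernel !wk_initial//.
by rewrite -!EFinM -EFinD; congr EFin; ring.
Qed.

Lemma resolvent_duhamel_kernel lam z w : (0 < lam)%R ->
  lam%:E * duhamel_kernel Omega G z w = resolvent_kernel Omega G lam z w +
    lam%:E * \int[mZ]_v (resolvent_kernel Omega G lam z v *
                         duhamel_kernel Omega G v w).
Proof.
move=> l0; have [w0|w0] := ltP 0%R w.2; last first.
  rewrite /duhamel_kernel /resolvent_kernel !wk_eq0// mule0 add0e.
  rewrite integral0_eq ?mule0// => v _.
  by rewrite (wk_eq0 _ w0) mule0.
under eq_integral do rewrite /duhamel_kernel wk_initial//.
have := @wkernel_comp (fun t => lam * expR (- lam * t))%R (fun=> 1%R) w.2 z w.1.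
rewrite /resolvent_kernel => ->//; last 2 first.
- by apply: expw_ge0; exact: ltW.
- exact: ltW.
under eq_integral do rewrite mulr1.
rewrite int_final ?ltW// /duhamel_kernel !wk_initial//.
by rewrite -!EFinM -EFinD; congr EFin; ring.
Qed.

Let kop_add_comp (k p a b : Z -> Z -> \bar R) lam (f : Z -> \bar R) z :
  (0 <= lam)%R -> kernel_fun k -> kernel_fun p -> kernel_fun a ->
  kernel_fun b -> measurable_fun setT f -> (forall w, 0 <= f w) ->
  (forall w, lam%:E * k z w =
    p z w + lam%:E * \int[mZ]_v (a z v * b v w)) ->
  lam%:E * kop mZ k f z = kop mZ p f z + lam%:E * kop mZ a (kop mZ b f) z.
Proof.
move=> l0 hk hp ha hb mf f0 E.
rewrite kop_comp//; set c := fun x w => _.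
have c0 w : 0 <= c z w by apply: integral_ge0 => v _; rewrite mule_ge0 ?ha.1 ?hb.1.
have mc : measurable_fun setT (c z).
  apply: (@measurable_fun_fubini_tonelli_G _ _ _ _ _ mZ
    (fun vw : Z * Z => a z vw.1 * b vw.1 vw.2)) => [|vw].
    apply: emeasurable_funM; last exact: hb.2.
    exact: (measurableT_comp (measurable_kernel_section z ha)).
  by rewrite mule_ge0 ?ha.1 ?hb.1.
rewrite /kop -!ge0_integralZl//; last 4 first.
- exact: emeasurable_funM.
- by move=> w _; rewrite mule_ge0.
- by apply: emeasurable_funM => //; exact: measurable_kernel_section.
- by move=> w _; rewrite mule_ge0// hk.1.
rewrite -ge0_integralD//; last 4 first.
- by move=> w _; rewrite mule_ge0// hp.1.
- by apply: emeasurable_funM => //; exact: measurable_kernel_section.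
- by move=> w _; rewrite !mule_ge0.
- by apply: emeasurable_funM => //; exact: emeasurable_funM.
apply: eq_integral => w _; rewrite muleA E ge0_muleDl ?hp.1//; first by rewrite muleA.
by apply: mule_ge0 => //; exact: (c0 w).
Qed.

(** The resolvent equation [lam L^-1 = P + lam L^-1 P = P + lam P L^-1], where
    [L] is the heat operator and [P = lam (lam + L)^-1]. *)
Lemma duhamel_resolvent lam f z : (0 < lam)%R -> measurable_fun setT f ->
  (forall w, 0 <= f w) ->
  lam%:E * K f z = P lam f z + lam%:E * K (P lam f) z.
Proof.
move=> l0 mf f0; apply: kop_add_comp => //.
- exact: ltW.
- exact: duhamel_kernel_kernel.
- by apply: resolvent_kernel_kernel; exact: ltW.
- exact: duhamel_kernel_kernel.
- by apply: resolvent_kernel_kernel; exact: ltW.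
- by move=> w; exact: duhamel_resolvent_kernel.
Qed.

Lemma resolvent_duhamel lam f z : (0 < lam)%R -> measurable_fun setT f ->
  (forall w, 0 <= f w) ->
  lam%:E * K f z = P lam f z + lam%:E * P lam (K f) z.
Proof.
move=> l0 mf f0; apply: kop_add_comp => //.
- exact: ltW.
- exact: duhamel_kernel_kernel.
- by apply: resolvent_kernel_kernel; exact: ltW.
- by apply: resolvent_kernel_kernel; exact: ltW.
- exact: duhamel_kernel_kernel.
- by move=> w; exact: resolvent_duhamel_kernel.
Qed.

(** [S (t - s) S s f = S t f] does not depend on [s], so that only the
    exponential weight is integrated, over [0 < s < t]. *)
Lemma resolvent_semigroup lam (f : V -> \bar R) (z : Z) :
  (0 < lam)%R -> measurable_fun setT f -> (forall y, 0 <= f y) ->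
  P lam (S f) z = (1 - expR (- lam * z.2))%:E * S f z.
Proof.
move=> l0 mf f0; have hp := resolvent_kernel_kernel (ltW l0).
rewrite kop_comp//; last exact: skernel_kernel.
rewrite {1}/kop (_ : (fun y => _) =
    fun y => (g z.2 z.1 y * (1 - expR (- lam * z.2)))%:E * f y); last first.
  apply/funext => y; congr (_ * _).
  have := @wkernel_comp (fun t => lam * expR (- lam * t))%R (fun=> 1%R) 0%R z y.
  move=> /(_ (mexpw lam) (measurable_cst _) (expw_ge0 (ltW l0)) (fun=> ler01)
    (lexx _)).
  under eq_integral do rewrite subr0 mul1r.
  under [in RHS]eq_integral do rewrite mulr1.
  by rewrite int_final// !subr0.
have [z0|z0] := leP z.2 0%R.
  rewrite /kop !integral0_eq ?mule0// => y _.
    by rewrite /skernel heat0_eq0 ?mul0e// => -[]; rewrite ltNge z0.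
  by rewrite heat0_eq0 ?mul0r ?mul0e// => -[]; rewrite ltNge z0.
rewrite /kop -ge0_integralZl//; last 3 first.
- apply: emeasurable_funM => //; apply: measurable_kernel_section.
  exact: skernel_kernel.
- by move=> y _; rewrite mule_ge0// lee_fin heat0_ge0.
- by rewrite lee_fin subr_ge0 -expR0 ler_expR mulNr oppr_le0 mulr_ge0// ltW.
by apply: eq_integral => y _; rewrite /skernel muleA -EFinM mulrC.
Qed.

End heat_kernel_algebra.

(** * Powers of solutions of the scalar problem *)

Section power_supersolution.
Local Open Scope ereal_scope.
Context {R : realType} {N : nat}.
Local Notation V := 'rV[R]_N.
Local Notation RR := (measurableTypeR R).
Local Notation Z := (V * RR)%type.
Local Notation leb := (@lebesgue_rV R N).
Local Notation mu := (@lebesgue_measure R).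
Local Notation mZ := (product_measure leb mu).
Variables (Omega : set V) (G : R -> V -> V -> R).
Hypothesis oOmega : open Omega.
Hypothesis hG : dirichlet_heat_kernel Omega G.
Local Notation K := (kop mZ (duhamel_kernel Omega G)).
Local Notation P lam := (kop mZ (resolvent_kernel Omega G lam)).
Local Notation S := (kop leb (skernel Omega G)).

Lemma wkernel_gt0P rho (z w : Z) : 0 < wkernel Omega G rho z w ->
  [/\ (0 < w.2)%R, (w.2 < z.2)%R, Omega z.1 & Omega w.1].
Proof.
rewrite /wkernel; have [w0|w0] := ltP 0%R w.2; last first.
  rewrite indicE memNset ?mul0r ?mulr0 ?ltxx//=.
  by rewrite in_itv/= andbT; apply/negP; rewrite -leNgt.
have [[h [? ?]]|h] := pselect (0 < z.2 - w.2 /\ Omega z.1 /\ Omega w.1)%R.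
  by move=> _; split=> //; rewrite -subr_gt0.
by rewrite heat0_eq0// !mulr0 ltxx.
Qed.

Lemma kop_wkernel_eq0 rho f (z : Z) : ~ ((0 < z.2)%R /\ Omega z.1) ->
  (forall w, 0 <= wkernel Omega G rho z w) ->
  kop mZ (wkernel Omega G rho) f z = 0.
Proof.
move=> Dz k0; apply: integral0_eq => w _.
have [->|kN] := eqVneq (wkernel Omega G rho z w) 0; first by rewrite mul0e.
have /wkernel_gt0P[w0 wz Oz _] : 0 < wkernel Omega G rho z w.
  by rewrite lt_neqAle eq_sym kN k0.
by case: Dz; split=> //; exact: lt_trans wz.
Qed.

Lemma measurable_expR_time (a : R) :
  measurable_fun setT (fun w : Z => (expR (a * w.2))%:E).
Proof.
apply/measurable_EFinP; apply: measurableT_comp; first exact: measurable_expR.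
by apply: measurable_funM => //; exact: measurable_snd.
Qed.

(** The exponential weight of the resolvent kernel turns its sub-Markov
    property into an estimate of the Duhamel operator. *)
Lemma duhamel_expR_le (a : R) z : (0 < a)%R ->
  K (fun w => (expR (a * w.2))%:E) z <= (expR (a * z.2) / a)%:E.
Proof.
move=> a0; have hp := resolvent_kernel_kernel oOmega hG (ltW a0).
have c0 : (0 <= expR (a * z.2) / a)%R by rewrite divr_ge0 ?expR_ge0// ltW.
rewrite [leLHS](_ : _ = (expR (a * z.2) / a)%:E * P a (cst 1) z); last first.
  rewrite /kop -ge0_integralZl//; last 2 first.
  - by apply: emeasurable_funM => //; exact: measurable_kernel_section.
  - by move=> w _; rewrite mule_ge0// hp.1.
  apply: eq_integral => w _; rewrite mule1 -!EFinM; congr EFin.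
  have -> : (expR (a * w.2) = expR (a * z.2) * expR (- a * (z.2 - w.2)))%R.
    by rewrite -expRD; congr expR; ring.
  by field; rewrite gt_eqF.
by rewrite -[leRHS]mule1 lee_wpmul2l ?lee_fin// resolvent_kernel_le1.
Qed.

Lemma resolvent_bounded (lam C : R) (f : Z -> \bar R) (z : Z) :
  (0 < lam)%R -> (0 <= C)%R ->
  measurable_fun setT f -> (forall w, 0 <= f w) ->
  (forall w, (0 < w.2)%R -> (w.2 < z.2)%R -> Omega w.1 -> f w <= C%:E) ->
  P lam f z <= C%:E.
Proof.
move=> l0 C0 mf f0 fC; have hp := resolvent_kernel_kernel oOmega hG (ltW l0).
apply: (@le_trans _ _ (P lam (fun w => C%:E * cst 1 w) z)).
  apply: kop_le => // w /wkernel_gt0P[w0 wz _ Ow].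
  by rewrite mule1; exact: fC.
rewrite kopZ// -[leRHS]mule1 lee_wpmul2l ?lee_fin//.
exact: resolvent_kernel_le1.
Qed.

Lemma duhamel_bounded (C : R) (f : Z -> \bar R) (z : Z) : (0 <= C)%R ->
  measurable_fun setT f -> (forall w, 0 <= f w) ->
  (forall w, (0 < w.2)%R -> (w.2 < z.2)%R -> Omega w.1 -> f w <= C%:E) ->
  K f z <= (C * expR z.2)%:E.
Proof.
move=> C0 mf f0 fC; have hk := duhamel_kernel_kernel oOmega hG.
apply: (@le_trans _ _ (K (fun w => C%:E * (expR (1 * w.2))%:E) z)).
  apply: kop_le => //.
    by apply: emeasurable_funM => //; exact: measurable_expR_time.
  move=> w /wkernel_gt0P[w0 wz _ Ow].
  apply: (le_trans (fC w w0 wz Ow)).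
  by rewrite -EFinM lee_fin ler_peMr// mul1r -expR0 ler_expR ltW.
rewrite kopZ//; last exact: measurable_expR_time.
rewrite EFinM lee_wpmul2l ?lee_fin//.
by have := @duhamel_expR_le 1 z ltr01; rewrite mul1r divr1.
Qed.

Section power.
Variables (phi : V -> \bar R) (W : Z -> R) (c A th : R).
Hypothesis mphi : measurable_fun setT phi.
Hypothesis phi0 : forall y, 0 <= phi y.
Hypothesis mW : measurable_fun setT W.
Hypothesis W0 : forall z, (0 <= W z)%R.
Hypothesis Wpos : forall z : Z, (0 < z.2)%R -> Omega z.1 -> (0 < W z)%R.
Hypothesis Wbounded : forall T : R, exists C : R, forall z : Z,
  (0 < z.2)%R -> (z.2 <= T)%R -> Omega z.1 -> (W z <= C)%R.
Hypothesis c0 : (0 < c)%R.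
Hypothesis A1 : (1 <= A)%R.
Hypothesis th01 : (0 < th <= 1)%R.
Let F (z : Z) : \bar R := (c * W z `^ A)%:E.
Hypothesis mild : forall z, (W z)%:E = S phi z + K F z.

Let mWpow a : measurable_fun setT (fun z => (W z `^ a)%:E).
Proof.
apply/measurable_EFinP.
exact: (measurableT_comp (measurable_powR a) mW).
Qed.

Let mF : measurable_fun setT F.
Proof.
rewrite (_ : F = fun z => c%:E * (W z `^ A)%:E); first exact: emeasurable_funM.
by apply/funext => z; rewrite -EFinM.
Qed.

Let F0 z : 0 <= F z.
Proof. by rewrite lee_fin mulr_ge0 ?powR_ge0// ltW. Qed.

Let hk := duhamel_kernel_kernel oOmega hG.
Let hp (lam : R) (l0 : (0 < lam)%R) := resolvent_kernel_kernel oOmega hG (ltW l0).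

Let mEW : measurable_fun setT (EFin \o W).
Proof. exact/measurable_EFinP. Qed.

(** [P W] differs from [W] by two terms that vanish as [lam] tends to infinity,
    without any continuity of [W]. *)
Let resolvent_mild (lam : R) (z : Z) : (0 < lam)%R ->
  (W z)%:E = P lam (EFin \o W) z +
  ((expR (- lam * z.2))%:E * S phi z + lam^-1%:E * P lam F z).
Proof.
move=> l0; have lN0 : lam != 0%R by rewrite gt_eqF.
have hs := skernel_kernel oOmega hG.
have mS : measurable_fun setT (S phi) by exact: measurable_kop.
have S0 w : 0 <= S phi w by exact: kop_ge0.
have [z0|z0] := ltP 0%R z.2; last first.
  have D0 : ~ ((0 < z.2)%R /\ Omega z.1) by case; rewrite ltNge z0.
  have K0 f : K f z = 0.
    by apply: kop_wkernel_eq0 => // w; exact: (hk.1 z w).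
  have P0 f : P lam f z = 0.
    by apply: kop_wkernel_eq0 => // w; exact: ((hp l0).1 z w).
  have SE : S phi z = 0.
    apply: integral0_eq => y _.
    by rewrite /skernel heat0_eq0 ?mul0e// => -[]; rewrite ltNge z0.
  by rewrite mild SE mule0 K0 !P0 mule0 !adde0.
have e01 : (0 <= 1 - expR (- lam * z.2))%R.
  by rewrite subr_ge0 -expR0 ler_expR mulNr oppr_le0 mulr_ge0// ltW.
have -> : P lam (EFin \o W) z =
    (1 - expR (- lam * z.2))%:E * S phi z + P lam (K F) z.
  rewrite -(resolvent_semigroup oOmega hG)// -kopD//; last 3 first.
  - exact: hp.
  - by apply: measurable_kop.
  - by move=> w; apply: kop_ge0.
  by apply: eq_kop => [w|w _]; [exact: (hp l0).1|rewrite /= mild].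
have -> : (W z)%:E = S phi z + (P lam (K F) z + lam^-1%:E * P lam F z).
  rewrite mild; congr (_ + _).
  have := @resolvent_duhamel _ _ _ _ oOmega hG lam F z l0 mF F0.
  move=> /(congr1 (fun x => lam^-1%:E * x)).
  rewrite muleA -EFinM mulVf// mul1e => ->.
  rewrite ge0_muleDr; last 2 first.
  - by apply: kop_ge0 => //; exact: hp.
  - apply: mule_ge0; first by rewrite lee_fin ltW.
    by apply: kop_ge0 => [|w]; [exact: hp|exact: kop_ge0].
  by rewrite muleA -EFinM mulVf// mul1e addeC.
rewrite [RHS]addeACA -ge0_muleDl ?lee_fin ?expR_ge0//.
by rewrite -EFinD subrK mul1e.
Qed.

Let resolvent_supersol (lam : R) (z : Z) : (0 < lam)%R -> (0 < z.2)%R -> Omega z.1 ->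
  (0 < W z)%R /\ P lam (EFin \o W) z + lam^-1%:E * P lam F z <= (W z)%:E.
Proof.
move=> l0 z0 Oz; split; first exact: Wpos.
rewrite (resolvent_mild z l0); apply: leeD2l.
rewrite leeDr// mule_ge0 ?lee_fin ?expR_ge0// kop_ge0//.
exact: skernel_kernel.
Qed.

(** Convexity of the power [A] is what replaces the convergence of [P F] to
    [F]. *)
Let P_tangent (lam : R) (z : Z) : (0 < lam)%R -> (0 < z.2)%R -> Omega z.1 ->
  (c * A * W z `^ (A - 1))%:E * P lam (EFin \o W) z <=
  P lam F z + (c * (A - 1) * W z `^ A)%:E.
Proof.
move=> l0 z0 Oz; have A0 : (0 <= A)%R by exact: le_trans A1.
have d0 : (0 <= c * A * W z `^ (A - 1))%R.
  by rewrite !mulr_ge0 ?powR_ge0// ltW.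
have e0 : (0 <= c * (A - 1) * W z `^ A)%R.
  by rewrite !mulr_ge0 ?powR_ge0 ?subr_ge0// ltW.
have hpl := hp l0.
rewrite -kopZ//.
apply: (@le_trans _ _ (P lam (fun w => F w +
    (c * (A - 1) * W z `^ A)%:E * cst 1 w) z)).
  apply: kop_le => //.
  - exact: emeasurable_funM.
  - by apply: emeasurable_funD => //; exact: emeasurable_funM.
  - by move=> y; rewrite mule_ge0 ?lee_fin//= lee_fin.
  - move=> y _; rewrite mule1 /= -EFinM -EFinD lee_fin.
    have := powR_ge_tangent A1 (Wpos z0 Oz) (W0 y).
    by move=> /(ler_wpM2l (ltW c0)); rewrite mulrDr !mulrA.
rewrite kopD//; last by move=> y; apply: mule_ge0.
apply: leeD2l; rewrite kopZ//.
rewrite -[leRHS]mule1; apply: lee_wpmul2l; first by rewrite lee_fin.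
exact: resolvent_kernel_le1.
Qed.

Let W_bounded_before (z : Z) : exists2 C : R, (0 <= C)%R &
  forall w : Z, (0 < w.2)%R -> (w.2 < z.2)%R -> Omega w.1 -> (W w <= C)%R.
Proof.
have [C WC] := Wbounded z.2; exists `|C|%R => // w w0 wz Ow.
by apply: (le_trans (WC w w0 (ltW wz) Ow)); exact: ler_norm.
Qed.

Let cvg_resolvent z : (0 < z.2)%R -> Omega z.1 ->
  P n.+1%:R (EFin \o W) z @[n --> \oo] --> (W z)%:E.
Proof.
move=> z0 Oz; have [C C0 WC] := W_bounded_before z.
pose D := (W z / z.2 + c * C `^ A)%R.
have SW : S phi z <= (W z)%:E.
  by rewrite mild leeDl// kop_ge0.
have lb n : (W z - n.+1%:R^-1 * D)%:E <= P n.+1%:R (EFin \o W) z.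
  have n0 : (0 < n.+1%:R :> R)%R by rewrite ltr0n.
  rewrite EFinB leeBlDr// [leLHS](resolvent_mild z n0); apply: leeD2l.
  rewrite /D mulrDr EFinD; apply: leeD.
    apply: (@le_trans _ _ ((n.+1%:R^-1 / z.2)%:E * (W z)%:E)); last first.
      by rewrite -EFinM lee_fin (mulrC (W z)) mulrA.
    apply: lee_pmul; last exact: SW.
    - by rewrite lee_fin expR_ge0.
    - by apply: kop_ge0 => //; exact: skernel_kernel.
    rewrite lee_fin mulNr expRN -invfM lef_pV2 ?posrE ?expR_gt0 ?mulr_gt0//.
    by apply: le_trans (expR_ge1Dx _); rewrite lerDr.
  rewrite EFinM; apply: lee_wpmul2l; first by rewrite lee_fin invr_ge0 ltW.
  apply: resolvent_bounded => //.
    by rewrite mulr_ge0 ?powR_ge0// ltW.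
  move=> w w0 wz Ow; rewrite lee_fin; apply: ler_wpM2l; first exact: ltW.
  apply: ge0_ler_powR; rewrite ?nnegrE//; first exact: le_trans A1.
  exact: WC.
have ub n : P n.+1%:R (EFin \o W) z <= (W z)%:E.
  have n0 : (0 < n.+1%:R :> R)%R by rewrite ltr0n.
  have [_] := resolvent_supersol n0 z0 Oz; apply: le_trans.
  rewrite leeDl//; apply: mule_ge0; first by rewrite lee_fin invr_ge0 ltW.
  by apply: kop_ge0 => //; exact: hp.
apply: (@squeeze_cvge _ _ _ _ (fun n => (W z - n.+1%:R^-1 * D)%:E) _
  (fun=> (W z)%:E)).
- by apply: nearW => n; rewrite lb ub.
- apply: cvg_EFin; first exact: nearW.
  rewrite -[X in _ --> X]subr0; apply: cvgB; first exact: cvg_cst.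
  rewrite -[X in _ --> X](mul0r D); apply: cvgM; last exact: cvg_cst.
  exact: cvg_harmonic.
- exact: cvg_cst.
Qed.

(** [W `^ th] is a supersolution of the linear problem with the source
    [c * th * W `^ (th - 1 + A)] that the chain rule would produce; the term in
    the squared gradient of [W] that it leaves out has the favourable sign
    because [th <= 1]. *)
Lemma duhamel_powR_le z :
  (c * th)%:E * K (fun w => (W w `^ (th - 1 + A))%:E) z <= (W z `^ th)%:E.
Proof.
have /andP[th0 th1] := th01.
have [[z0 Oz]|Dz] := pselect ((0 < z.2)%R /\ Omega z.1); last first.
  rewrite kop_wkernel_eq0// ?mule0 ?lee_fin ?powR_ge0// => w.
  exact: (hk.1 z w).
have [C C0 WC] := W_bounded_before z.
have A0 : (0 <= A)%R by exact: le_trans A1.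
have q0 : (0 <= th - 1 + A)%R.
  by rewrite -addrA addr_ge0 ?(ltW th0)// addrC subr_ge0.
pose Wq (w : Z) : \bar R := (W w `^ (th - 1 + A))%:E.
have Wq0 w : 0 <= Wq w by rewrite lee_fin powR_ge0.
have Kfin a : (0 <= a)%R -> K (fun w => (W w `^ a)%:E) z < +oo.
  move=> a0; apply: le_lt_trans (ltry (C `^ a * expR z.2)).
  apply: duhamel_bounded => //; first exact: powR_ge0.
    by move=> w; rewrite lee_fin powR_ge0.
  by move=> w w0 wz Ow; rewrite lee_fin ge0_ler_powR ?nnegrE// WC.
have KWq_fin : K Wq z \is a fin_num.
  by rewrite ge0_fin_numE; [exact: Kfin|exact: kop_ge0].
(* The claim for [P F] in place of [F]; the terms [f_ n] below, which bound
   [W `^ (th - 1) * P F] from below up to a multiple of [W `^ (th - 1 + A)],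
   only involve [P W], whose limit is known. *)
have main n : th%:E * K (fun w => (W w `^ (th - 1))%:E * P n.+1%:R F w) z <=
    (W z `^ th)%:E.
  have n0 : (0 < n.+1%:R :> R)%R by rewrite ltr0n.
  apply: (@kop_concave_power _ _ _ mZ (duhamel_kernel Omega G)
    (resolvent_kernel Omega G n.+1%:R) n.+1%:R) => //.
  - exact: hp.
  - by move=> f w mf f0; exact: duhamel_resolvent.
  - by move=> w; exact: resolvent_kernel_le1.
  - exact: resolvent_supersol.
  - by move=> w /wkernel_gt0P[w0 wz _ Ow]; exact: resolvent_supersol.
  - by apply: Kfin; exact: ltW.
pose f_ n (w : Z) : \bar R := (c * A * W w `^ (th - 1) * W w `^ (A - 1))%:E *
  P n.+1%:R (EFin \o W) w.
have mf_ n : measurable_fun setT (f_ n).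
  have n0 : (0 < n.+1%:R :> R)%R by rewrite ltr0n.
  apply: emeasurable_funM; last by apply: measurable_kop => //; exact: hp.
  apply/measurable_EFinP; apply: measurable_funM; last first.
    exact: (measurableT_comp (measurable_powR (A - 1)) mW).
  apply: measurable_funM => //.
  exact: (measurableT_comp (measurable_powR (th - 1)) mW).
have f_0 n w : 0 <= f_ n w.
  have n0 : (0 < n.+1%:R :> R)%R by rewrite ltr0n.
  apply: mule_ge0; first by rewrite lee_fin !mulr_ge0 ?powR_ge0// ltW.
  by apply: kop_ge0 => [|v]; [exact: hp|rewrite lee_fin].
have Kf_ n : K (f_ n) z <= (W z `^ th / th)%:E + (c * (A - 1))%:E * K Wq z.
  have n0 : (0 < n.+1%:R :> R)%R by rewrite ltr0n.
  have mPF : measurable_fun setT (P n.+1%:R F).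
    by apply: measurable_kop => //; exact: hp.
  have PF0 w : 0 <= P n.+1%:R F w by apply: kop_ge0 => //; exact: hp.
  have d0 : (0 <= c * (A - 1))%R by rewrite mulr_ge0 ?subr_ge0// ltW.
  apply: (@le_trans _ _ (K (fun w => (W w `^ (th - 1))%:E * P n.+1%:R F w +
      (c * (A - 1))%:E * Wq w) z)).
    apply: kop_le => //.
      apply: emeasurable_funD; apply: emeasurable_funM => //; exact: mWpow.
    move=> w /wkernel_gt0P[w0 wz _ Ow].
    have := P_tangent n0 w0 Ow.
    move=> /(lee_wpmul2l (_ : 0 <= (W w `^ (th - 1))%:E)).
    rewrite lee_fin powR_ge0 => /(_ erefl); rewrite muleA -EFinM.
    rewrite [leRHS]ge0_muleDr//; last first.
      by rewrite lee_fin !mulr_ge0 ?powR_ge0 ?subr_ge0// ltW.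
    rewrite -EFinM [X in (_ + (X)%:E)](_ : _ =
        c * (A - 1) * W w `^ (th - 1 + A))%R; last first.
      by rewrite mulrCA -powRD// (gt_eqF (Wpos w0 Ow)) implybT.
    rewrite EFinM; apply: le_trans.
    by rewrite /f_ (_ : c * A * W w `^ (th - 1) * W w `^ (A - 1) =
      W w `^ (th - 1) * (c * A * W w `^ (A - 1)))%R//; ring.
  rewrite kopD//; last 4 first.
  - by apply: emeasurable_funM => //; exact: mWpow.
  - by apply: emeasurable_funM => //; exact: mWpow.
  - by move=> w; apply: mule_ge0 => //; rewrite lee_fin powR_ge0.
  - by move=> w; apply: mule_ge0.
  rewrite kopZ//; last exact: mWpow.
  rewrite leeD2r//.
  have := main n => /(lee_wpmul2l (_ : 0 <= th^-1%:E)).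
  rewrite lee_fin invr_ge0 ltW// => /(_ erefl).
  by rewrite muleA -!EFinM mulVf ?gt_eqF// mul1e mulrC.
have lim : K (fun w => (c * A)%:E * Wq w) z <=
    (W z `^ th / th)%:E + (c * (A - 1))%:E * K Wq z.
  apply: (@le_kop_lim _ _ _ _ _ mZ _ f_) => // w /wkernel_gt0P[w0 wz _ Ow].
  rewrite (_ : (c * A)%:E * Wq w =
    (c * A * W w `^ (th - 1) * W w `^ (A - 1))%:E * (W w)%:E).
    by apply: cvgeZl => //; exact: cvg_resolvent.
  rewrite -!EFinM -!mulrA (mulrC _ (W w)) mulr_powRB1 ?ltW ?Wpos//; last first.
    exact: lt_le_trans A1.
  by rewrite -powRD// (gt_eqF (Wpos w0 Ow)) implybT.
move: lim; rewrite kopZ//; [|exact: mWpow|by rewrite mulr_ge0// ltW].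
rewrite -(fineK KWq_fin) -!EFinM -EFinD !lee_fin => lim.
have {}lim : (c * fine (K Wq z) <= W z `^ th / th)%R by lra.
by rewrite mulrAC -ler_pdivlMr.
Qed.

End power.

End power_supersolution.

(** * From supersolutions to solutions of the system *)

Section existence.
Local Open Scope ereal_scope.
Context {R : realType} {N : nat}.
Local Notation V := 'rV[R]_N.
Local Notation RR := (measurableTypeR R).
Local Notation Z := (V * RR)%type.
Local Notation leb := (@lebesgue_rV R N).
Local Notation mu := (@lebesgue_measure R).
Local Notation mZ := (product_measure leb mu).
Variables (Omega : set V) (G : R -> V -> V -> R).
Hypothesis oOmega : open Omega.
Hypothesis hG : dirichlet_heat_kernel Omega G.
Local Notation K := (kop mZ (duhamel_kernel Omega G)).
Local Notation S := (kop leb (skernel Omega G)).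

Lemma measurable_ext (f : V -> R) : measurable_fun Omega f ->
  measurable_fun setT (EFin \o f \_ Omega).
Proof.
move=> mf; have mO := measurable_Omega oOmega.
apply/measurable_EFinP.
by apply/(measurable_restrict _ mO measurableT); rewrite setTI.
Qed.

Lemma ext_ge0 (f : V -> R) : (forall x, Omega x -> 0 <= f x)%R ->
  forall x, 0 <= (EFin \o f \_ Omega) x.
Proof.
move=> f0 x; rewrite /= lee_fin patchE; case: ifPn => // xO.
by apply: f0; rewrite inE in xO.
Qed.

Lemma heat_semigroupE t (f : V -> R) x : (0 < t)%R -> Omega x ->
  heat_semigroup Omega G t f x = \int[leb]_y (heat0 Omega G t x y * f y)%:E.
Proof.
move=> t0 Ox; rewrite /heat_semigroup integral_mkcond; apply: eq_integral => y _.
rewrite patchE; case: ifPn; first by rewrite inE => Oy; rewrite heat0E.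
by rewrite notin_setE => Oy; rewrite heat0_eq0 ?mul0r// => -[_ [_ /Oy]].
Qed.

Lemma heat_semigroup_kop t (f : V -> R) x : (0 < t)%R -> Omega x ->
  heat_semigroup Omega G t f x = S (EFin \o f \_ Omega) (x, t).
Proof.
move=> t0 Ox; rewrite heat_semigroupE//; apply: eq_integral => y _.
rewrite /skernel /= -EFinM patchE; case: ifPn => //.
rewrite notin_setE => Oy.
by rewrite heat0_eq0 ?mul0r// => -[_ [_ /Oy]].
Qed.

Lemma duhamel_integral_kop (f : Z -> R) (z : Z) : measurable_fun setT f ->
  (forall w, 0 <= f w)%R -> (0 < z.2)%R -> Omega z.1 ->
  \int[mu]_(s in `]0%R, z.2[)
    heat_semigroup Omega G (z.2 - s) (fun y => f (y, s)) z.1 =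
  K (EFin \o f) z.
Proof.
move=> mf f0 z0 Oz; have hk := duhamel_kernel_kernel oOmega hG.
rewrite /kop integral_spacetime; last 2 first.
- apply: emeasurable_funM; first exact: measurable_kernel_section.
  exact/measurable_EFinP.
- by move=> w; rewrite mule_ge0 ?hk.1// lee_fin.
rewrite integral_mkcond; apply: eq_integral => r _; rewrite patchE; case: ifPn.
  rewrite inE/= in_itv/= => /andP[r0 rz].
  rewrite heat_semigroupE ?subr_gt0//; apply: eq_integral => y _.
  rewrite /duhamel_kernel /wkernel indicE mem_set/= ?mul1r ?EFinM//.
  by rewrite in_itv/= r0.
rewrite notin_setE/= in_itv/= => /negP h.
rewrite integral0_eq// => y _.
have [->|kN] := eqVneq (duhamel_kernel Omega G z (y, r)) 0; first by rewrite mul0e.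
have /wkernel_gt0P[/= r0 rz _ _] : 0 < duhamel_kernel Omega G z (y, r).
  by rewrite lt_neqAle eq_sym kN hk.1.
by move: h; rewrite r0 rz.
Qed.

Lemma skernel_gt0P (z : Z) y : 0 < skernel Omega G z y ->
  [/\ (0 < z.2)%R, Omega z.1 & Omega y].
Proof. exact: heat0_gt0P. Qed.

(** A pair lying above the right-hand sides of the integral equations bounds
    from above the increasing iteration started at zero, whose limit solves
    the system. *)
Lemma solution_below_supersolution (p q : R) (u0 v0 : V -> R) (U U' : Z -> R) :
  (0 <= p)%R -> (0 <= q)%R ->
  measurable_fun Omega u0 -> measurable_fun Omega v0 ->
  (forall x, Omega x -> 0 <= u0 x)%R -> (forall x, Omega x -> 0 <= v0 x)%R ->
  measurable_fun setT U -> measurable_fun setT U' ->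
  (forall z, S (EFin \o u0 \_ Omega) z + K (fun w => (U' w `^ p)%:E) z <=
    (U z)%:E) ->
  (forall z, S (EFin \o v0 \_ Omega) z + K (fun w => (U w `^ q)%:E) z <=
    (U' z)%:E) ->
  (forall T : R, exists C : R, forall z : Z, (0 < z.2)%R -> (z.2 <= T)%R ->
    Omega z.1 -> (U z <= C /\ U' z <= C)%R) ->
  exists u v : Z -> R,
  [/\ system_solution Omega G p q u0 v0 (fun x t => u (x, t)) (fun x t => v (x, t)),
      measurable_fun setT u /\ measurable_fun setT v,
      (forall z, 0 <= u z)%R /\ (forall z, 0 <= v z)%R,
      (forall z, (u z)%:E =
        S (EFin \o u0 \_ Omega) z + K (fun w => (v w `^ p)%:E) z) &
      (forall z, (v z)%:E =
        S (EFin \o v0 \_ Omega) z + K (fun w => (u w `^ q)%:E) z)].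
Proof.
move=> p0 q0 mu0 mv0 u00 v00 mU mU' hU hU' bU.
have hk := duhamel_kernel_kernel oOmega hG.
have hs := skernel_kernel oOmega hG.
pose e b := if b then p else q.
pose phi (b : bool) : Z -> \bar R :=
  if b then S (EFin \o u0 \_ Omega) else S (EFin \o v0 \_ Omega).
pose UU (b : bool) := if b then U else U'.
have [||||||w [mw w0 wU wE]] := @monotone_iteration _ _ _ mZ _ hk _ e phi UU.
- by [].
- by case.
- by case; apply: measurable_kop => //;
    [exact: measurable_ext|exact: ext_ge0|exact: measurable_ext|exact: ext_ge0].
- by case=> z; apply: kop_ge0 => //; exact: ext_ge0.
- by case.
- by case=> z; [exact: hU|exact: hU'].
have mpow b r : measurable_fun setT (fun z => w b z `^ r)%R.
  exact: (measurableT_comp (measurable_powR r) (mw b)).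
have adm b : admissible Omega (fun x t => w b (x, t)).
  split.
  - rewrite (_ : (fun z => _) = w b); first exact: measurable_funTS.
    by apply/funext => -[].
  - by move=> x t _ _; exact: w0.
  - move=> t1 t2 t10 t12; have [C HC] := bU t2; exists C => x t Ox /andP[tt1 tt2].
    apply: (le_trans (wU b (x, t))).
    have [] := HC (x, t) (lt_trans t10 tt1) (ltW tt2) Ox.
    by case: b.
have duh b f0 : measurable_fun Omega f0 -> phi b = S (EFin \o f0 \_ Omega) ->
    duhamel Omega G f0 (fun x t => w (~~ b) (x, t) `^ e b)%R (fun x t => w b (x, t)).
  move=> mf0 phiE; apply: (@aeW _ _ _ (leb \x mu)) => -[x t] [/= Ox].
  rewrite /halfline/= in_itv/= andbT => t0.
  rewrite heat_semigroup_kop// wE phiE; congr (_ + _).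
  rewrite -(@duhamel_integral_kop (fun z => w (~~ b) z `^ e b)%R (x, t))//.
  by move=> z; exact: powR_ge0.
exists (w true), (w false); split=> //.
by split; [exact: adm|exact: adm|exact: (duh true)|exact: (duh false)].
Qed.

End existence.

(** * Global solutions for [p * q <= 1] *)

Section integral_positivity.
Local Open Scope ereal_scope.
Context d (T : measurableType d) {R : realType} (m : {measure set T -> \bar R}).

Lemma ge0_integral_eq0_ae (f : T -> \bar R) : measurable_fun setT f ->
  (forall x, 0 <= f x) -> \int[m]_x f x = 0 -> {ae m, forall x, f x = 0}.
Proof.
move=> mf f0 intf0.
have : \int[m]_x `|f x| = 0.
  by rewrite -intf0; apply: eq_integral => x _; rewrite gee0_abs.
move/(ae_eq_integral_abs m measurableT mf).
by apply: filterS => x /(_ Logic.I).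
Qed.

Lemma integral_gt0 (A : set T) (f : T -> \bar R) : measurable A -> 0 < m A ->
  measurable_fun setT f -> (forall x, 0 <= f x) ->
  (forall x, A x -> 0 < f x) -> 0 < \int[m]_x f x.
Proof.
move=> mA A0 mf f0 fA; rewrite lt_neqAle integral_ge0// andbT.
apply/eqP => /esym/(ge0_integral_eq0_ae mf f0) [B [mB B0 AB]].
suff : m A <= m B by rewrite B0 leNgt A0.
apply: le_measure; rewrite ?inE// => x Ax; apply: AB => /= fx.
by have := fA x Ax; rewrite fx ltxx.
Qed.

End integral_positivity.

Section bounded_data.
Local Open Scope ereal_scope.
Context {R : realType} {N : nat}.
Local Notation V := 'rV[R]_N.
Local Notation RR := (measurableTypeR R).
Local Notation Z := (V * RR)%type.
Local Notation leb := (@lebesgue_rV R N).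
Local Notation mu := (@lebesgue_measure R).
Local Notation mZ := (product_measure leb mu).
Variables (Omega : set V) (G : R -> V -> V -> R).
Hypothesis oOmega : open Omega.
Hypothesis hG : dirichlet_heat_kernel Omega G.
Local Notation K := (kop mZ (duhamel_kernel Omega G)).
Local Notation S := (kop leb (skernel Omega G)).

Lemma semigroup_ae_bounded (f : V -> R) (M : R) z : measurable_fun Omega f ->
  (forall x, Omega x -> 0 <= f x)%R -> (0 <= M)%R ->
  {ae leb, forall x, Omega x -> f x <= M}%R ->
  S (EFin \o f \_ Omega) z <= M%:E.
Proof.
move=> mf f0 M0 fM; have hs := skernel_kernel oOmega hG.
apply: (@le_trans _ _ (S (fun y => M%:E * cst 1 y) z)); last first.
  rewrite kopZ// -[leRHS]mule1 lee_wpmul2l ?lee_fin//.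
  rewrite /kop; under eq_integral do rewrite mule1.
  exact: (heat0_le1 hG).
apply: ae_ge0_le_integral => //.
- by move=> y _; rewrite mule_ge0 ?hs.1// ext_ge0.
- apply: emeasurable_funM; first exact: measurable_kernel_section.
  exact: measurable_ext.
- by move=> y _; rewrite mule_ge0 ?hs.1// mule_ge0// lee_fin.
- apply: emeasurable_funM; first exact: measurable_kernel_section.
  exact: emeasurable_funM.
apply: filterS fM => y fM _; apply: lee_wpmul2l; first exact: hs.1.
rewrite mule1 /= lee_fin patchE; case: ifPn => //.
by rewrite inE => /fM.
Qed.

(** Exponents [a], [b] for which [(C e^(a t), C e^(b t))] is a supersolution:
    the requirements [p * b <= a] and [q * a <= b] are compatible exactly
    because [p * q <= 1]. *)
Lemma exponential_rates (p q C : R) : (0 <= p)%R -> (0 <= q)%R ->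
  (p * q <= 1)%R -> exists a b : R,
  [/\ 0 < a, 0 < b, p * b <= a, q * a <= b & C `^ p <= a /\ C `^ q <= b]%R.
Proof.
move=> p0 q0 pq1; have Cp := powR_ge0 C p; have Cq := powR_ge0 C q.
have [qE|qN] := eqVneq q 0%R.
  exists (p * (C `^ q + 1) + C `^ p + 1)%R, (C `^ q + 1)%R.
  have h : (0 <= p * (C `^ q + 1))%R by rewrite mulr_ge0 ?addr_ge0.
  have qx x : (q * x = 0)%R by rewrite qE mul0r.
  by split; rewrite ?qx; [lra|lra|lra|lra|split; lra].
have qgt0 : (0 < q)%R by rewrite lt_neqAle eq_sym qN.
exists (C `^ p + (C `^ q + 1) / q + 1)%R, (q * (C `^ p + (C `^ q + 1) / q + 1))%R.
set a := (C `^ p + _ + 1)%R.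
have h : (0 <= (C `^ q + 1) / q)%R by rewrite divr_ge0 ?addr_ge0.
have a0 : (0 < a)%R by rewrite /a; lra.
have ba : (C `^ q <= q * a)%R.
  rewrite /a !mulrDr mulr1 (mulrCA q) divff// mulr1.
  have : (0 <= q * C `^ p)%R by rewrite mulr_ge0.
  lra.
split=> //; [by rewrite mulr_gt0| |by split=> //; rewrite /a; lra].
by rewrite mulrA -[leRHS]mul1r ler_wpM2r// ltW.
Qed.

Lemma powR_expR (a x r : R) : (0 <= a)%R ->
  ((a * expR x) `^ r = a `^ r * expR (r * x))%R.
Proof.
by move=> a0; rewrite powRM ?expR_ge0// (mulrC r) expRM.
Qed.

Lemma exponential_supersolution (r a b M : R) (f : V -> R) z : (0 <= r)%R ->
  (0 < a)%R -> (0 <= M)%R -> (r * b <= a)%R -> ((M + 1) `^ r <= a)%R ->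
  measurable_fun Omega f -> (forall x, Omega x -> 0 <= f x)%R ->
  {ae leb, forall x, Omega x -> f x <= M}%R ->
  S (EFin \o f \_ Omega) z +
    K (fun w => (((M + 1) * expR (b * w.2)) `^ r)%:E) z <=
  ((M + 1) * expR (a * z.2))%:E.
Proof.
move=> r0 a0 M0 rb Ma mf f0 fM.
have hk := duhamel_kernel_kernel oOmega hG.
have M1 : (0 <= M + 1)%R by rewrite addr_ge0.
have [[z0 Oz]|Dz] := pselect ((0 < z.2)%R /\ Omega z.1); last first.
  rewrite kop_wkernel_eq0//; last by move=> w; exact: (hk.1 z w).
  rewrite adde0 /kop integral0_eq; first by rewrite lee_fin mulr_ge0// expR_ge0.
  move=> y _; rewrite /skernel heat0_eq0 ?mul0e// => -[? [? _]].
  exact: Dz.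
have KE : K (fun w => (((M + 1) * expR (b * w.2)) `^ r)%:E) z <= (expR (a * z.2))%:E.
  apply: (@le_trans _ _ (K (fun w => a%:E * (expR (a * w.2))%:E) z)).
    apply: kop_le => //.
    - under eq_fun do rewrite powR_expR// EFinM mulrA.
      by apply: emeasurable_funM => //; exact: measurable_expR_time.
    - by apply: emeasurable_funM => //; exact: measurable_expR_time.
    - by move=> w; rewrite lee_fin powR_ge0.
    move=> w /wkernel_gt0P[w0 wz _ Ow]; rewrite powR_expR// -EFinM lee_fin.
    apply: ler_pM => //; rewrite ?powR_ge0 ?expR_ge0//.
    by rewrite ler_expR mulrA ler_wpM2r// ltW.
  rewrite kopZ//; [|exact: measurable_expR_time|exact: ltW].
  apply: (le_trans (lee_wpmul2l _ (duhamel_expR_le oOmega hG z a0))).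
    by rewrite lee_fin ltW.
  by rewrite -EFinM lee_fin mulrC divfK// gt_eqF.
apply: (le_trans (leeD (semigroup_ae_bounded z mf f0 M0 fM) KE)).
rewrite -EFinD lee_fin mulrDl mul1r lerD2r.
by rewrite ler_peMr// -expR0 ler_expR mulr_ge0// ltW.
Qed.

Lemma global_solution_bounded_data (p q : R) (u0 v0 : V -> R) :
  (0 <= p)%R -> (0 <= q)%R -> (p * q <= 1)%R ->
  ess_bounded Omega u0 -> ess_bounded Omega v0 ->
  (forall x, Omega x -> 0 <= u0 x)%R -> (forall x, Omega x -> 0 <= v0 x)%R ->
  exists u v, system_solution Omega G p q u0 v0 u v.
Proof.
move=> p0 q0 pq1 [mu0 [M1 u0M]] [mv0 [M2 v0M]] u00 v00.
pose M := Num.max `|M1|%R `|M2|%R.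
have M0 : (0 <= M)%R by rewrite le_max normr_ge0.
have {}u0M : {ae leb, forall x, Omega x -> u0 x <= M}%R.
  apply: filterS u0M => x h Ox.
  apply: (le_trans (ler_norm _)); apply: (le_trans (h Ox)).
  by apply: (le_trans (ler_norm _)); rewrite le_max lexx.
have {}v0M : {ae leb, forall x, Omega x -> v0 x <= M}%R.
  apply: filterS v0M => x h Ox.
  apply: (le_trans (ler_norm _)); apply: (le_trans (h Ox)).
  by apply: (le_trans (ler_norm _)); rewrite le_max lexx orbT.
have [a [b [a0 b0 pba qab [Ca Cb]]]] := exponential_rates (M + 1) p0 q0 pq1.
have mexp (c : R) : measurable_fun setT (fun z : Z => (M + 1) * expR (c * z.2))%R.
  apply: measurable_funM => //.
  by apply/measurable_EFinP; exact: measurable_expR_time.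
have [|u [v [sol _ _ _ _]]] := @solution_below_supersolution _ _ _ _ oOmega hG
  p q u0 v0 _ _ p0 q0 mu0 mv0 u00 v00 (mexp a) (mexp b)
  (fun z => exponential_supersolution z p0 a0 M0 pba Ca mu0 u00 u0M)
  (fun z => exponential_supersolution z q0 b0 M0 qab Cb mv0 v00 v0M).
  move=> T; exists ((M + 1) * (expR (a * T) + expR (b * T)))%R => z z0 zT _.
  have h c : (0 < c)%R -> (expR (c * z.2) <= expR (c * T))%R.
    by move=> c0; rewrite ler_expR ler_wpM2l// ltW.
  have e1 := expR_ge0 (a * T)%R; have e2 := expR_ge0 (b * T)%R.
  have ha := h a a0; have hb := h b b0.
  by split; apply: ler_wpM2l; rewrite ?addr_ge0//; lra.
by exists (fun x t => u (x, t)), (fun x t => v (x, t)).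
Qed.

End bounded_data.

(** * Restarting a solution at a positive time *)

Section lebesgue_translation.
Local Open Scope ereal_scope.
Context {R : realType}.
Local Notation RR := (measurableTypeR R).
Local Notation mu := (@lebesgue_measure R).

Lemma ge0_integral_translation (tau : R) (f : RR -> \bar R) :
  measurable_fun setT f -> (forall x, 0 <= f x) ->
  \int[mu]_s f (s + tau)%R = \int[mu]_s f s.
Proof.
move=> mf f0; pose h (s : RR) : RR := (s + tau)%R.
have mh : measurable_fun setT h by exact: measurable_funD.
have E : \int[pushforward mu h]_s f s = \int[mu]_s f s.
  apply: eq_measure_integral => A mA _; apply/esym.
  apply: lebesgue_measure_unique => // _ [[a b] _ <-].
  have hE : h @^-1` `]a, b]%classic = `](a - tau)%R, (b - tau)%R]%classic.
    by apply/seteqP; split=> x /=; rewrite !in_itv/= /h ltrBlDr lerBrDr.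
  transitivity (mu (h @^-1` `]a, b]%classic)); last by [].
  rewrite hE !lebesgue_measure_itv/= !lte_fin ltrD2r.
  by case: ifPn => // _; rewrite -!EFinB; congr EFin; ring.
by rewrite -E ge0_integral_pushforward// => s _.
Qed.

End lebesgue_translation.

Section sections.
Local Open Scope ereal_scope.
Context {R : realType} {N : nat}.
Local Notation V := 'rV[R]_N.
Local Notation RR := (measurableTypeR R).
Local Notation Z := (V * RR)%type.
Local Notation leb := (@lebesgue_rV R N).
Local Notation mu := (@lebesgue_measure R).
Local Notation mZ := (product_measure leb mu).

Let indic_integral (A : set Z) : measurable A -> mZ A = 0 ->
  \int[mu]_r \int[leb]_x (\1_A (x, r))%:E = 0.
Proof.
move=> mA A0.
rewrite -(@integral_spacetime _ _ (fun z : Z => (\1_A z)%:E)); last 2 first.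
- by apply/measurable_EFinP; exact: measurable_indic.
- by move=> w; rewrite lee_fin.
by rewrite integral_indic// setIT.
Qed.

Let mindic_slice (A : set Z) r : measurable A ->
  measurable_fun setT (fun x : V => (\1_A (x, r))%:E : \bar R).
Proof.
move=> mA; apply: (measurable_fun_pair1 (f := fun z : Z => (\1_A z)%:E : \bar R)).
by apply/measurable_EFinP; exact: measurable_indic.
Qed.

Let mindic_int (A : set Z) : measurable A ->
  measurable_fun setT (fun r : RR => \int[leb]_x (\1_A (x, r))%:E).
Proof.
move=> mA; apply: (@measurable_fun_fubini_tonelli_G _ _ _ _ _ leb
  (fun z : Z => (\1_A z)%:E)) => [|z]; last by rewrite lee_fin.
by apply/measurable_EFinP; exact: measurable_indic.
Qed.

Lemma ae_time_slice (Q : Z -> Prop) : {ae mZ, forall z, Q z} ->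
  {ae mu, forall r, {ae leb, forall x, Q (x, r)}}.
Proof.
move=> [A [mA A0 QA]].
have H : {ae mu, forall r, \int[leb]_x (\1_A (x, r))%:E = 0}.
  apply: (ge0_integral_eq0_ae (mindic_int mA)); last exact: indic_integral.
  by move=> r; apply: integral_ge0 => x _; rewrite lee_fin.
apply: filterS H => r Hr.
have : {ae leb, forall x, (\1_A (x, r))%:E = 0 :> \bar R}.
  apply: (ge0_integral_eq0_ae (mindic_slice r mA) _ Hr).
  by move=> x; rewrite lee_fin.
apply: filterS => x; rewrite indicE; case: (boolP (_ \in _)) => [_ /eqP|].
  by rewrite eqe oner_eq0.
by rewrite notin_setE => nA _; apply: contrapT => nQ; apply: nA; exact: QA.
Qed.

Lemma ae_translation (tau : R) (Q : Z -> Prop) : {ae mZ, forall z, Q z} ->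
  {ae mZ, forall z : Z, Q (z.1, z.2 + tau)%R}.
Proof.
move=> [A [mA A0 QA]].
pose h (z : Z) : Z := (z.1, z.2 + tau)%R.
have mh : measurable_fun setT h.
  apply: measurable_fun_pair => //.
  by apply: measurable_funD => //; exact: measurable_snd.
exists (h @^-1` A); split; first by rewrite -[X in measurable X]setTI; exact: mh.
  have mhA : measurable (h @^-1` A) by rewrite -[X in measurable X]setTI; exact: mh.
  transitivity (\int[mu]_r \int[leb]_x (\1_A (x, (r + tau)%R))%:E).
    rewrite -[h @^-1` A]setIT -integral_indic//.
    rewrite (@integral_spacetime _ _ (fun z : Z => (\1_(h @^-1` A) z)%:E))//.
    by apply/measurable_EFinP; exact: measurable_indic.
  rewrite (@ge0_integral_translation R tau
    (fun r => \int[leb]_x (\1_A (x, r))%:E)) ?indic_integral//.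
  - exact: mindic_int.
  - by move=> r; apply: integral_ge0 => x _; rewrite lee_fin.
by move=> z nQ; apply: QA.
Qed.

End sections.

Section restart.
Local Open Scope ereal_scope.
Context {R : realType} {N : nat}.
Local Notation V := 'rV[R]_N.
Local Notation RR := (measurableTypeR R).
Local Notation Z := (V * RR)%type.
Local Notation leb := (@lebesgue_rV R N).
Local Notation mu := (@lebesgue_measure R).
Local Notation mZ := (product_measure leb mu).
Variables (Omega : set V) (G : R -> V -> V -> R).
Hypothesis oOmega : open Omega.
Hypothesis hG : dirichlet_heat_kernel Omega G.
Local Notation K := (kop mZ (duhamel_kernel Omega G)).
Local Notation S := (kop leb (skernel Omega G)).
Variables (tau t : R) (x : V).
Hypothesis tau0 : (0 < tau)%R.
Hypothesis t0 : (0 < t)%R.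

Lemma semigroup_restart (f : V -> \bar R) : measurable_fun setT f ->
  (forall y, 0 <= f y) ->
  S f (x, t + tau)%R = S (fun xi => S f (xi, tau)) (x, t).
Proof.
move=> mf f0; have [s0 ms] := skernel_kernel oOmega hG.
pose l (xi y : V) := skernel Omega G (xi, tau) y.
have hl : kernel_fun l.
  split=> [xi y|]; first exact: s0.
  have mg : measurable_fun setT (fun w : V * V => ((w.1, tau : RR), w.2)).
    by apply: measurable_fun_pair => //; exact: measurable_fun_pair.
  exact: (measurableT_comp ms mg).
have -> : (fun xi => S f (xi, tau)) = kop leb l f by [].
rewrite kop_comp//; apply: eq_integral => y _; congr (_ * _).
rewrite /skernel /l /=; under eq_integral do rewrite -EFinM.
by rewrite (heat0_semigroup hG).
Qed.

Let H (F : Z -> \bar R) (r : RR) : \bar R :=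
  \int[leb]_y ((heat0 Omega G (t + tau - r) x y)%:E * F (y, r)).

Let mH F : measurable_fun setT F -> (forall w, 0 <= F w) ->
  measurable_fun setT (H F).
Proof.
move=> mF F0; apply: (@measurable_fun_fubini_tonelli_G _ _ _ _ _ leb
  (fun w : Z => (heat0 Omega G (t + tau - w.2) x w.1)%:E * F w)) => [|w].
  apply: emeasurable_funM => //; apply/measurable_EFinP.
  have mg : measurable_fun setT (fun w : Z => (t + tau - w.2 : RR, (x, w.1)))%R.
    apply: measurable_fun_pair.
      by apply: measurable_funB => //; exact: measurable_snd.
    by apply: measurable_fun_pair => //; exact: measurable_fst.
  exact: (measurableT_comp (measurable_heat0 oOmega hG) mg).
by rewrite mule_ge0// lee_fin heat0_ge0.
Qed.

Let H0 F r : (forall w, 0 <= F w) -> 0 <= H F r.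
Proof.
by move=> F0; apply: integral_ge0 => y _; rewrite mule_ge0// lee_fin heat0_ge0.
Qed.

(** The sources before and after time [tau] contribute to the restarted data
    and to the restarted Duhamel integral respectively. *)
Lemma duhamel_restart (F : Z -> \bar R) : measurable_fun setT F ->
  (forall w, 0 <= F w) ->
  K F (x, t + tau)%R = S (fun xi => K F (xi, tau)) (x, t) +
    K (fun w => F (w.1, w.2 + tau)%R) (x, t).
Proof.
move=> mF F0; have hk := duhamel_kernel_kernel oOmega hG.
have hs := skernel_kernel oOmega hG; have [k0 mk] := hk.
pose l (xi : V) (w : Z) := duhamel_kernel Omega G (xi, tau) w.
have hl : kernel_fun l.
  split=> [xi y|]; first exact: k0.
  have mg : measurable_fun setT (fun w : V * Z => ((w.1, tau : RR), w.2)).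
    by apply: measurable_fun_pair => //; exact: measurable_fun_pair.
  exact: (measurableT_comp mk mg).
have mHF := mH mF F0.
have E1 : K F (x, t + tau)%R = \int[mu]_(r in `]0%R, +oo[) H F r.
  rewrite /kop integral_spacetime; last 2 first.
  - by apply: emeasurable_funM => //; exact: measurable_kernel_section.
  - by move=> w; rewrite mule_ge0.
  rewrite [RHS]integral_mkcond; apply: eq_integral => r _; rewrite patchE.
  case: ifPn => [rI|rI].
    by apply: eq_integral => y _; rewrite /duhamel_kernel /wkernel indicE rI !mul1r.
  apply: integral0_eq => y _; rewrite /duhamel_kernel /wkernel indicE (negbTE rI).
  by rewrite mul0r mulr0 mul0e.
have E2 : S (fun xi => K F (xi, tau)) (x, t) = \int[mu]_(r in `]0%R, tau[) H F r.
  have -> : (fun xi => K F (xi, tau)) = kop mZ l F by [].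
  rewrite kop_comp// /kop.
  rewrite (_ : (fun w => _) = (fun w => (fun w : Z =>
      (heat0 Omega G (t + tau - w.2) x w.1)%:E) \_ (setT `*` `]0%R, tau[) w * F w));
    last first.
    apply/funext => -[y r]; congr (_ * _); rewrite patchE; case: ifPn.
      rewrite inE/= in_itv/= => -[_ /andP[r0 rt]].
      rewrite -addrA -(heat0_semigroup hG)// ?subr_gt0//.
      apply: eq_integral => xi _; rewrite /skernel /l /duhamel_kernel /wkernel/=.
      rewrite indicE mem_set/=; last by rewrite in_itv/= r0.
      by rewrite !mul1r -EFinM.
    rewrite notin_setE/= in_itv/= => rI; apply: integral0_eq => xi _.
    have [->|lN] := eqVneq (l xi (y, r)) 0; first by rewrite mule0.
    have /wkernel_gt0P[/= r0 rt _ _] : 0 < l xi (y, r).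
      by rewrite lt_neqAle eq_sym lN hl.1.
    by case: rI; rewrite r0 rt.
  rewrite integral_spacetime; last 2 first.
  - apply: emeasurable_funM => //.
    apply/(measurable_restrict _ _ measurableT).
      by apply: measurableX => //; exact: measurable_itv.
    apply: measurable_funTS; apply/measurable_EFinP.
    have mg : measurable_fun setT (fun w : Z => (t + tau - w.2 : RR, (x, w.1)))%R.
      apply: measurable_fun_pair.
        by apply: measurable_funB => //; exact: measurable_snd.
      by apply: measurable_fun_pair => //; exact: measurable_fst.
    exact: (measurableT_comp (measurable_heat0 oOmega hG) mg).
  - move=> w; rewrite mule_ge0// patchE; case: ifPn => // _.
    by rewrite lee_fin heat0_ge0.
  rewrite [RHS]integral_mkcond; apply: eq_integral => r _; rewrite patchE.
  case: ifPn => [rI|rI].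
    apply: eq_integral => y _; rewrite patchE ifT//.
    by rewrite inE; split => //=; rewrite inE in rI.
  apply: integral0_eq => y _; rewrite patchE ifF ?mul0e//.
  apply/negbTE; rewrite notin_setE => -[_ /= h].
  by move/negP: rI; apply; rewrite inE.
have E3 : K (fun w => F (w.1, w.2 + tau)%R) (x, t) =
    \int[mu]_(r in `]tau, +oo[) H F r.
  rewrite /kop integral_spacetime; last 2 first.
  - apply: emeasurable_funM; first exact: measurable_kernel_section.
    have mg : measurable_fun setT (fun w : Z => (w.1, w.2 + tau)%R : Z).
      apply: measurable_fun_pair => //.
      by apply: measurable_funD => //; exact: measurable_snd.
    exact: (measurableT_comp mF mg).
  - by move=> w; rewrite mule_ge0.
  rewrite [RHS]integral_mkcond.
  rewrite -(@ge0_integral_translation R tau (H F \_ `]tau, +oo[)); last 2 first.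
  - have mI : @measurable _ RR `]tau, +oo[%classic by exact: measurable_itv.
    by apply/(measurable_restrict _ mI measurableT); exact: measurable_funTS.
  - by move=> r; rewrite patchE; case: ifPn => // _; exact: H0.
  apply: eq_integral => r _; rewrite patchE /duhamel_kernel /wkernel/= indicE.
  rewrite (_ : (r + tau \in `]tau, +oo[%classic) = (r \in `]0%R, +oo[%classic))%R;
    last first.
    by apply/idP/idP; rewrite !inE/= !in_itv/= !andbT ltrDr.
  case: ifPn => rI.
    apply: eq_integral => y _; rewrite !mul1r; congr ((heat0 _ _ _ _ _)%:E * _).
    by rewrite opprD addrACA subrr addr0.
  by apply: integral0_eq => y _; rewrite mul0r mulr0 mul0e.
rewrite E1 E2 E3 (_ : `]0%R, +oo[%classic = `]0%R, tau[ `|` `[tau, +oo[); last first.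
  apply/seteqP; split=> r /=; rewrite !in_itv/= !andbT.
    by move=> r0; have [rt|rt] := ltP r tau; [left; rewrite r0|right].
  by move=> [/andP[]//|]; exact: lt_le_trans.
rewrite ge0_integral_setU//.
- congr (_ + _); apply/esym/integral_itv_obnd_cbnd.
  exact: measurable_funTS.
- exact: measurable_funTS.
- by move=> r _; exact: H0.
- apply/disj_setPS => r [/=]; rewrite !in_itv/= andbT => /andP[_ rt].
  by rewrite leNgt rt.
Qed.

End restart.

(** * Positive global solutions of the system *)

Section positive_solutions.
Local Open Scope ereal_scope.
Context {R : realType} {N : nat}.
Local Notation V := 'rV[R]_N.
Local Notation RR := (measurableTypeR R).
Local Notation Z := (V * RR)%type.
Local Notation leb := (@lebesgue_rV R N).
Local Notation mu := (@lebesgue_measure R).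
Local Notation mZ := (product_measure leb mu).
Variables (Omega : set V) (G : R -> V -> V -> R).
Hypothesis oOmega : open Omega.
Hypothesis hG : dirichlet_heat_kernel Omega G.
Hypothesis Omega_neq0 : Omega !=set0.
Local Notation K := (kop mZ (duhamel_kernel Omega G)).
Local Notation S := (kop leb (skernel Omega G)).

Let mO := measurable_Omega oOmega.
Let hk := duhamel_kernel_kernel oOmega hG.
Let hs := skernel_kernel oOmega hG.

(** Otherwise the Chapman-Kolmogorov integral over [Omega] would vanish. *)
Lemma lebesgue_Omega_gt0 : 0 < leb Omega.
Proof.
have [x Ox] := Omega_neq0; rewrite lt_neqAle measure_ge0 andbT.
apply/eqP => /esym O0.
have := dhk_semigroup hG ltr01 ltr01 Ox Ox.
rewrite null_set_integral//.
- by move=> /eqP; rewrite eqe lt_eqF// (dhk_gt0 hG)// addr_gt0.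
- have mg y : measurable_fun setT
      (fun z : V => heat0 Omega G 1%R x z * heat0 Omega G 1%R z y)%R.
    apply: measurable_funM.
      have mh : measurable_fun setT (fun z : V => (1%R : RR, (x, z))).
        by apply: measurable_fun_pair => //; exact: measurable_fun_pair.
      exact: (measurableT_comp (measurable_heat0 oOmega hG) mh).
    have mh : measurable_fun setT (fun z : V => (1%R : RR, (z, y))).
      by apply: measurable_fun_pair => //; exact: measurable_fun_pair.
    exact: (measurableT_comp (measurable_heat0 oOmega hG) mh).
  apply: (eq_measurable_fun (fun z => (heat0 Omega G 1%R x z * heat0 Omega G 1%R z x)%:E)).
    by move=> z; rewrite inE => Oz; rewrite !heat0E.
  by apply/measurable_EFinP; apply: measurable_funTS; exact: mg.
Qed.

Lemma semigroup_gt0 (f : V -> R) z : measurable_fun Omega f ->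
  (forall x, Omega x -> 0 < f x)%R -> (0 < z.2)%R -> Omega z.1 ->
  0 < S (EFin \o f \_ Omega) z.
Proof.
move=> mf f0 z0 Oz; apply: (integral_gt0 mO lebesgue_Omega_gt0).
- by apply: emeasurable_funM; [exact: measurable_kernel_section|exact: measurable_ext].
- by move=> y; rewrite mule_ge0 ?hs.1// ext_ge0// => y' /f0/ltW.
- move=> y Oy; rewrite /skernel heat0E//= patchE mem_set//.
  by rewrite -EFinM lte_fin mulr_gt0 ?f0// (dhk_gt0 hG).
Qed.

Lemma duhamel_gt0 (f : Z -> R) (z : Z) : measurable_fun setT f ->
  (forall w, 0 <= f w)%R -> (forall w, (0 < w.2)%R -> Omega w.1 -> 0 < f w)%R ->
  (0 < z.2)%R -> Omega z.1 -> 0 < K (EFin \o f) z.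
Proof.
move=> mf f0 fpos z0 Oz.
apply: (@integral_gt0 _ _ _ mZ (Omega `*` (`]0%R, z.2[%classic : set RR))).
- by apply: measurableX => //; exact: measurable_itv.
- rewrite [X in 0 < X](@product_measure1E _ _ _ _ _ leb mu)//.
  apply: mule_gt0; first exact: lebesgue_Omega_gt0.
  suff : 0 < mu `]0%R, z.2[%classic by [].
  by rewrite lebesgue_measure_itv/= lte_fin z0 oppr0 adde0 lte_fin.
- by apply: emeasurable_funM; [exact: measurable_kernel_section|exact/measurable_EFinP].
- by move=> w; rewrite mule_ge0 ?hk.1// lee_fin.
- move=> [y r] [/= Oy]; rewrite in_itv/= => /andP[r0 rz].
  rewrite -EFinM lte_fin mulr_gt0 ?fpos// mul1r indicE mem_set/=; last first.
    by rewrite in_itv/= r0.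
  by rewrite mul1r heat0E ?subr_gt0// (dhk_gt0 hG)// subr_gt0.
Qed.

Lemma ae_exists_pos (Q : RR -> Prop) : {ae mu, forall r, Q r} ->
  exists2 tau : R, (0 < tau)%R & Q tau.
Proof.
move=> [B [mB B0 QB]]; apply: contrapT => H.
have : mu `]0%R, 1%R[%classic <= mu B.
  have mI : @measurable _ RR `]0%R, 1%R[%classic by exact: measurable_itv.
  apply: le_measure; rewrite ?inE//.
  move=> r /=; rewrite in_itv/= => /andP[r0 _].
  have nQ : ~ Q r by move=> Qr; exact: (H (ex_intro2 _ _ r r0 Qr)).
  exact: (QB r nQ).
by rewrite B0 lebesgue_measure_itv/= lte_fin ltr01 oppr0 adde0 lee_fin ler10.
Qed.

Section scalar_solution.
Variables (alpha A : R) (w0 : V -> R) (w : V -> R -> R).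
Hypothesis alpha0 : (0 < alpha)%R.
Hypothesis A0 : (0 < A)%R.
Hypothesis hw0 : initial_function Omega w0.
Hypothesis hw : scalar_solution Omega G alpha alpha A A w0 w.
Hypothesis wpos : positive_on Omega w.

Let D : set Z := Omega `*` (halfline : set RR).
Let we : Z -> R := (fun z => w z.1 z.2) \_ D.
Let F (z : Z) : \bar R := (2 * alpha * we z `^ A)%:E.
Let rhs (z : Z) : \bar R := S (EFin \o w0 \_ Omega) z + K F z.

Let DP z : D z <-> (0 < z.2)%R /\ Omega z.1.
Proof.
rewrite /D /halfline; split=> [[Oz]|[z0 Oz]]; first by rewrite /= in_itv/= andbT.
by split=> //=; rewrite in_itv/= z0.
Qed.

Let weE x t : (0 < t)%R -> Omega x -> we (x, t) = w x t.
Proof. by move=> t0 Ox; rewrite /we patchE mem_set//; exact/DP. Qed.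

Let mwe : measurable_fun setT we.
Proof.
have mD : measurable D by apply: measurableX => //; exact: measurable_itv.
apply/(measurable_restrict _ mD measurableT); rewrite setTI.
by have [[]] := hw.
Qed.

Let we0 z : (0 <= we z)%R.
Proof.
rewrite /we patchE; case: ifPn => //; rewrite inE => /DP[z0 Oz].
exact/ltW/wpos.
Qed.

Let mF : measurable_fun setT F.
Proof.
apply/measurable_EFinP; apply: measurable_funM => //.
exact: (measurableT_comp (measurable_powR A) mwe).
Qed.

Let c0 : (0 < 2 * alpha)%R. Proof. by rewrite mulr_gt0. Qed.

Let F0 z : 0 <= F z.
Proof. by rewrite lee_fin mulr_ge0 ?powR_ge0// ltW. Qed.

Let we_rhs : {ae mZ, forall z, D z -> (we z)%:E = rhs z}.
Proof.
have [_ [B [mB B0 sB]]] := hw.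
exists B; split=> // -[x t] nP; apply: (sB (x, t)) => duh.
apply: nP => Dxt; have /DP[/= t0 Ox] := Dxt.
rewrite weE// (duh Dxt) /= heat_semigroup_kop//; congr (_ + _).
have mf : measurable_fun setT (fun z => 2 * alpha * we z `^ A)%R.
  exact/measurable_EFinP.
rewrite -(@duhamel_integral_kop _ _ _ _ oOmega hG
  (fun z => 2 * alpha * we z `^ A)%R (x, t) mf F0 t0 Ox).
apply: eq_integral => s; rewrite inE/= in_itv/= => /andP[s0 _].
apply: eq_integral => y; rewrite inE => Oy.
by rewrite weE//; congr (_ * _)%:E; ring.
Qed.

(** A solution is only assumed bounded away from the initial time, and may
    start from data that vanish almost everywhere.  Restarted at almost any
    positive time it has bounded positive data, is bounded on bounded time
    intervals, and can be modified on a null set so that the integral equation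
    holds everywhere. *)
Lemma scalar_solution_restart : exists (phi : V -> R) (W : Z -> R),
  [/\ measurable_fun Omega phi, (forall x, Omega x -> 0 < phi x)%R &
      exists M : R, forall x, Omega x -> (phi x <= M)%R] /\
  [/\ measurable_fun setT W, (forall z, 0 <= W z)%R,
      (forall z : Z, 0 < z.2 -> Omega z.1 -> 0 < W z)%R,
      (forall T : R, exists C : R, forall z : Z,
        (0 < z.2 -> z.2 <= T -> Omega z.1 -> W z <= C)%R) &
      forall z, (W z)%:E = S (EFin \o phi \_ Omega) z +
        K (fun y => (2 * alpha * W y `^ A)%:E) z].
Proof.
have [tau tau0 Htau] := ae_exists_pos (ae_time_slice we_rhs).
have [[_ _ wbd] _] := hw.
pose phi x := we (x, tau).
have mphi : measurable_fun setT phi by exact: measurable_fun_pair1.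
have mphiO : measurable_fun Omega phi by exact: measurable_funTS.
have phi_pos x : Omega x -> (0 < phi x)%R.
  by move=> Ox; rewrite /phi weE//; exact: wpos.
have phi0 x : Omega x -> (0 <= phi x)%R by move=> Ox; exact/ltW/phi_pos.
have [M phiM] : exists M : R, forall x, Omega x -> (phi x <= M)%R.
  have t1 : (0 < tau / 2)%R by rewrite divr_gt0.
  have [M HM] := wbd (tau / 2)%R (tau + 1)%R t1 ltac:(lra).
  exists M => x Ox; rewrite /phi weE//; apply: HM => //; apply/andP; split; lra.
pose Ft (z : Z) : \bar R := F (z.1, z.2 + tau)%R.
have msh : measurable_fun setT (fun z : Z => (z.1, z.2 + tau)%R : Z).
  apply: measurable_fun_pair => //.
  by apply: measurable_funD => //; exact: measurable_snd.
have mFt : measurable_fun setT Ft by exact: (measurableT_comp mF msh).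
have Ft0 z : 0 <= Ft z by exact: F0.
have Ft_bd (T : R) : exists2 C : R, (0 <= C)%R & forall z : Z, (0 < z.2)%R ->
    (z.2 <= T)%R -> Omega z.1 -> Ft z <= C%:E.
  have [C HC] := wbd tau (tau + `|T| + 1)%R tau0 ltac:(have := normr_ge0 T; lra).
  exists (2 * alpha * `|C| `^ A)%R; first by rewrite mulr_ge0 ?powR_ge0// ltW.
  move=> z z0 zT Oz; rewrite /Ft /F weE ?addr_gt0// lee_fin.
  apply: ler_wpM2l; first exact: ltW.
  apply: ge0_ler_powR; rewrite ?nnegrE//; first exact: ltW.
    by apply/ltW/wpos => //; rewrite addr_gt0.
  apply: le_trans (ler_norm C); apply: HC => //.
  by have := ler_norm T; move=> h; apply/andP; split; lra.
pose rhs' z := S (EFin \o phi \_ Omega) z + K Ft z.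
have S0 z : 0 <= S (EFin \o phi \_ Omega) z.
  by apply: kop_ge0 => //; exact: ext_ge0.
have K0 z : 0 <= K Ft z by exact: kop_ge0.
have mS : measurable_fun setT (S (EFin \o phi \_ Omega)).
  by apply: measurable_kop => //; [exact: measurable_ext|exact: ext_ge0].
have mK : measurable_fun setT (K Ft) by exact: measurable_kop.
have rhsE z : (0 < z.2)%R -> Omega z.1 -> rhs (z.1, z.2 + tau)%R = rhs' z.
  case: z => x t /= t0 Ox.
  have [_ w00 _] := hw0; have [mw0 _ _] := hw0.
  rewrite /rhs /= (semigroup_restart oOmega hG x tau0 t0
    (measurable_ext oOmega mw0) (ext_ge0 w00)).
  rewrite (duhamel_restart oOmega hG x tau0 t0 mF F0) addeA /rhs'.
  apply: (f_equal (fun s => s + K Ft (x, t))).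
  have mSx : measurable_fun setT (S (EFin \o w0 \_ Omega)).
    by apply: measurable_kop => //; [exact: measurable_ext|exact: ext_ge0].
  have mKx : measurable_fun setT (K F) by exact: measurable_kop.
  have Sx0 z : 0 <= S (EFin \o w0 \_ Omega) z.
    by apply: kop_ge0 => //; exact: ext_ge0.
  have Kx0 z : 0 <= K F z by exact: kop_ge0.
  have m1 := measurable_fun_pair1 tau mSx.
  have m2 := measurable_fun_pair1 tau mKx.
  rewrite -kopD//; apply: ae_eq_kop => //.
  - exact: emeasurable_funD.
  - exact: measurable_ext.
  - by move=> y; rewrite adde_ge0.
  - exact: ext_ge0.
  apply: filterS Htau => y Hy /skernel_gt0P[_ _ Oy].
  by rewrite /= patchE mem_set//; apply/esym/Hy/DP.
have rhs_out z : ~ ((0 < z.2)%R /\ Omega z.1) -> rhs' z = 0.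
  move=> Dz; rewrite /rhs' kop_wkernel_eq0//; last by move=> v; exact: (hk.1 z v).
  rewrite adde0; apply: integral0_eq => y _.
  by rewrite /skernel heat0_eq0 ?mul0e// => -[? [? _]]; exact: Dz.
have rhs_bd (T : R) : exists C : R, forall z : Z,
    (z.2 <= T)%R -> rhs' z <= C%:E.
  have [C C0 HC] := Ft_bd T.
  exists (`|M| + C * expR T)%R => z zT; rewrite EFinD; apply: leeD.
    apply: semigroup_ae_bounded => //; apply: aeW => x Ox.
    by apply: le_trans (ler_norm M); exact: phiM.
  apply: (@le_trans _ _ (C * expR z.2)%:E).
    apply: duhamel_bounded => // v v0 vz Ov; apply: HC => //.
    exact: le_trans (ltW vz) zT.
  by rewrite lee_fin ler_wpM2l// ler_expR.
have rhs_fin z : rhs' z \is a fin_num.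
  have [C HC] := rhs_bd z.2; rewrite ge0_fin_numE; last by rewrite adde_ge0.
  exact: le_lt_trans (HC z (lexx _)) (ltry C).
pose W z := fine (rhs' z).
have WE z : (W z)%:E = rhs' z by rewrite fineK.
have W0 z : (0 <= W z)%R by rewrite fine_ge0// adde_ge0.
have mW : measurable_fun setT W.
  by apply: measurable_fine_comp; exact: emeasurable_funD.
clearbody W; exists phi, W; split.
  by split; [exact: mphiO|exact: phi_pos|exists M].
split; [exact: mW|exact: W0| | |].
- move=> z z0 Oz; rewrite -lte_fin WE.
  by apply: (lt_le_trans (semigroup_gt0 mphiO phi_pos z0 Oz)); rewrite leeDl.
- move=> T; have [C HC] := rhs_bd T; exists C => z _ zT _.
  by rewrite -lee_fin WE; exact: HC.
- move=> z; rewrite WE /rhs'; apply: (f_equal (fun s => _ + s)).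
  apply: ae_eq_kop; [exact: hk|exact: mFt| |exact: Ft0| |].
  + apply/measurable_EFinP; apply: measurable_funM => //.
    exact: (measurableT_comp (measurable_powR A) mW).
  + by move=> y; rewrite lee_fin mulr_ge0 ?powR_ge0// ltW.
  apply: filterS (ae_translation tau we_rhs) => y Hy /wkernel_gt0P[y0 _ _ Oy].
  rewrite /Ft /F; congr (_ * _ `^ _)%:E; apply: EFin_inj.
  by rewrite WE -rhsE// Hy//; apply/DP; split=> //=; rewrite addr_gt0.
Qed.

End scalar_solution.

(** The heat kernel with a fixed pole is integrable and bounded below on
    compact subsets, so these have finite measure. *)
Lemma bounded_initial_function (f : V -> R) (M : R) :
  measurable_fun Omega f -> (forall x, Omega x -> 0 <= f x)%R ->
  (forall x, Omega x -> f x <= M)%R -> initial_function Omega f.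
Proof.
move=> mf f0 fM; split=> // C CO cC.
have mC : measurable C.
  rewrite -[C]setCK; apply: measurableC; apply: open_measurable_rV.
  by rewrite openC; apply: compact_closed => //; exact: norm_hausdorff.
have [x Ox] := Omega_neq0.
have cG y : Omega y -> {for y, continuous (fun y => (G 1%R x y)^-1)%R}.
  move=> Oy.
  apply: (@cvgV R V (nbhs y) _ (fun y => G 1%R x y) (G 1%R x y)).
    by apply: lt0r_neq0; exact: (dhk_gt0 hG ltr01 Ox Oy).
  pose Q : set (R * (V * V)) := halfline `*` (Omega `*` Omega).
  have oQ : open Q.
    by apply: open_setX; [exact: itv_open_ends_open|exact: open_setX].
  have Qy : (1%R, (x, y)) \in Q.
    by rewrite inE; split=> //=; rewrite /halfline/= in_itv/= ltr01.
  have := dhk_continuous hG; rewrite continuous_open_subspace// => /(_ _ Qy) cG.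
  apply: (@continuous_comp V (R * (V * V))%type R (fun y => (1%R, (x, y)))
    (fun z => G z.1 z.2.1 z.2.2)) => //.
  apply: (@cvg_pair _ _ _ (nbhs y) (nbhs (1%R : R)) (nbhs (x, y)) _ _ _
    (fun=> 1%R) (fun y => (x, y))); first exact: (@cvg_cst R 1%R V (nbhs y)).
  apply: (@cvg_pair _ _ _ (nbhs y) (nbhs x) (nbhs y) _ _ _ (fun=> x) id) => //.
  exact: (@cvg_cst V x V (nbhs y)).
have cGC : {within C, continuous (fun y => (G 1 x y)^-1)%R}.
  by apply: continuous_in_subspaceT => y; rewrite inE => /CO; exact: cG.
have [B [_ HB]] := @compact_bounded R R _ (continuous_compact cGC cC).
have {}HB y : C y -> (1 <= `|B + 1| * G 1 x y)%R.
  move=> Cy; have Oy := CO y Cy; have g0 := dhk_gt0 hG ltr01 Ox Oy.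
  rewrite -ler_pdivrMr// mul1r.
  apply: le_trans (ler_norm (B + 1)).
  apply: le_trans (ler_norm _) _.
  by apply: (HB (B + 1)%R); [rewrite ltrDl|exists y].
have mg : measurable_fun setT (fun y : V => (heat0 Omega G 1 x y)%:E).
  apply/measurable_EFinP.
  have mh : measurable_fun setT (fun z : V => (1%R : RR, (x, z))).
    by apply: measurable_fun_pair => //; exact: measurable_fun_pair.
  exact: (measurableT_comp (measurable_heat0 oOmega hG) mh).
have c0 : (0 <= `|M| * `|B + 1|)%R by rewrite mulr_ge0.
apply: (@le_lt_trans _ _ (\int[leb]_(y in C)
    ((`|M| * `|B + 1|)%:E * (heat0 Omega G 1 x y)%:E))).
  apply: ge0_le_integral => //.
  - by move=> y /CO Oy; rewrite lee_fin f0.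
  - by apply/measurable_EFinP; apply: measurable_funS mf.
  - by apply: emeasurable_funM => //; exact: measurable_funTS.
  move=> y Cy; have Oy := CO y Cy; rewrite heat0E// -EFinM lee_fin -mulrA.
  apply: (@le_trans _ _ `|M|%R); first exact: le_trans (fM y Oy) (ler_norm M).
  by rewrite -[leLHS]mulr1 ler_wpM2l// HB.
apply: (@le_lt_trans _ _ (\int[leb]_y
    ((`|M| * `|B + 1|)%:E * (heat0 Omega G 1 x y)%:E))).
  apply: ge0_subset_integral => //; first exact: emeasurable_funM.
  by move=> y _; rewrite mule_ge0 ?lee_fin// heat0_ge0.
rewrite ge0_integralZl//; last by move=> y _; rewrite lee_fin heat0_ge0.
apply: le_lt_trans (ltry (`|M| * `|B + 1|)%R); rewrite -[leRHS]mule1.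
by apply: lee_wpmul2l; [rewrite lee_fin|exact: (heat0_le1 hG)].
Qed.

(** The pair [(W, W `^ th)] is a supersolution: the exponents are chosen so that
    [th * p = A] in the first equation and [th - 1 + A = q] in the second, and
    [alpha = th^-1] makes both multiplicative constants at least one.  The
    ordering of [p] and [q] gives [th <= 1]. *)
Lemma positive_solution_ordered (p q pstar : R) : (0 <= q)%R -> (q <= p)%R ->
  (1 < pstar)%R ->
  (forall alpha beta A B : R, 1 <= alpha -> 1 <= beta -> 0 <= A -> 0 <= B ->
    pstar < Num.min A B ->
    has_positive_scalar_solution Omega G alpha beta A B)%R ->
  (pstar - 1 < (p * q - 1) / (p + 1))%R ->
  exists u0 v0 u v,
    [/\ initial_function Omega u0, initial_function Omega v0,
        system_solution Omega G p q u0 v0 u v,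
        positive_on Omega u & positive_on Omega v].
Proof.
move=> q0 qp pstar1 hscalar hpq.
have p0 : (0 <= p)%R by exact: le_trans qp.
have p1 : (0 < p + 1)%R by rewrite ltr_wpDl.
have q1 : (0 < q + 1)%R by rewrite ltr_wpDl.
pose th : R := ((q + 1) / (p + 1))%R.
pose A : R := (p * (q + 1) / (p + 1))%R.
pose alpha : R := ((p + 1) / (q + 1))%R.
have th01 : (0 < th <= 1)%R.
  by rewrite /th divr_gt0//= ler_pdivrMr// mul1r lerD2r.
have alpha1 : (1 <= alpha)%R by rewrite /alpha ler_pdivlMr// mul1r lerD2r.
have A_pstar : (pstar < A)%R.
  have -> : A = ((p * q - 1) / (p + 1) + 1)%R by rewrite /A; field; rewrite gt_eqF.
  by rewrite -ltrBlDr.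
have A1 : (1 < A)%R by exact: lt_trans A_pstar.
have A0 : (0 < A)%R by exact: lt_trans A1.
have alpha0 : (0 < alpha)%R by exact: lt_le_trans alpha1.
have thA : (th - 1 + A = q)%R by rewrite /th /A; field; rewrite gt_eqF.
have calpha : (2 * alpha * th = 2)%R.
  by rewrite /alpha /th; field; rewrite !gt_eqF.
have c0 : (0 < 2 * alpha)%R by rewrite mulr_gt0.
have [w0 [w [hw0 hw wpos]]] : has_positive_scalar_solution Omega G alpha alpha A A.
  by apply: hscalar => //; rewrite ?minxx// ltW.
have [phi [W [[mphi phipos [M phiM]] [mW W0 Wpos Wbd mild]]]] :=
  scalar_solution_restart alpha0 A0 hw0 hw wpos.
have phi0 x : Omega x -> (0 <= phi x)%R by move=> Ox; exact/ltW/phipos.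
have mpow r : measurable_fun setT (fun z => W z `^ r)%R.
  exact: (measurableT_comp (measurable_powR r) mW).
have mEpow r : measurable_fun setT (fun z => (W z `^ r)%:E).
  by apply/measurable_EFinP; exact: mpow.
have powW := duhamel_powR_le oOmega hG (measurable_ext oOmega mphi) (ext_ge0 phi0)
  mW W0 Wpos Wbd c0 (ltW A1) th01 mild.
pose zero : V -> R := fun=> 0%R.
have S0 z : S (EFin \o zero \_ Omega) z = 0.
  by apply: integral0_eq => y _; rewrite /= patchE; case: ifP; rewrite mule0.
have sup1 z : S (EFin \o phi \_ Omega) z +
    K (fun y => ((W y `^ th) `^ p)%:E) z <= (W z)%:E.
  rewrite mild; apply: leeD2l; apply: kop_le => //.
  - under eq_fun do rewrite -powRrM.
    exact: mEpow.
  - under eq_fun do rewrite EFinM.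
    exact: emeasurable_funM.
  - by move=> y; rewrite lee_fin powR_ge0.
  move=> y _; rewrite lee_fin -powRrM.
  have -> : (th * p = A)%R by rewrite /th /A mulrAC (mulrC p).
  by rewrite ler_peMl ?powR_ge0//; lra.
have sup2 z : S (EFin \o zero \_ Omega) z +
    K (fun y => (W y `^ q)%:E) z <= (W z `^ th)%:E.
  rewrite S0 add0e; have := powW z; rewrite thA calpha.
  apply: le_trans; rewrite -[leLHS]mul1e lee_wpmul2r//.
    by apply: kop_ge0 => // y; rewrite lee_fin powR_ge0.
  by rewrite lee_fin ler1n.
have bd (T : R) : exists C : R, forall z : Z, (0 < z.2)%R -> (z.2 <= T)%R ->
    Omega z.1 -> (W z <= C /\ W z `^ th <= C)%R.
  have [C WC] := Wbd T; exists (Num.max C (`|C| `^ th))%R => z z0 zT Oz.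
  have h := WC z z0 zT Oz; rewrite !le_max h/=; split=> //; apply/orP; right.
  have /andP[th0 _] := th01.
  apply: ge0_ler_powR; rewrite ?nnegrE//; first exact: ltW.
  exact: le_trans h (ler_norm C).
have mzero : measurable_fun Omega zero by exact: measurable_cst.
have zero0 x : Omega x -> (0 <= zero x)%R by [].
have [u [v [sol [mu' mv'] [u0 v0] uE vE]]] :=
  @solution_below_supersolution _ _ _ _ oOmega hG p q phi zero _ _ p0 q0
    mphi mzero phi0 zero0 mW (mpow th) sup1 sup2 bd.
have upos (z : Z) : (0 < z.2)%R -> Omega z.1 -> (0 < u z)%R.
  move=> z0 Oz; rewrite -lte_fin uE.
  apply: (lt_le_trans (semigroup_gt0 mphi phipos z0 Oz)).
  by rewrite leeDl// kop_ge0// => y; rewrite lee_fin powR_ge0.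
exists phi, zero, (fun x t => u (x, t)), (fun x t => v (x, t)); split=> //.
- exact: bounded_initial_function phiM.
- by apply: (@bounded_initial_function zero 0%R).
- by move=> x t Ox t0; exact: upos.
move=> x t Ox t0; rewrite -lte_fin vE S0 add0e.
apply: (@duhamel_gt0 (fun z => u z `^ q)%R) => //.
- exact: (measurableT_comp (measurable_powR q) mu').
- by move=> y; exact: powR_ge0.
- by move=> y y0 Oy; rewrite powR_gt0// upos.
Qed.

Lemma system_solution_sym (p q : R) (u0 v0 : V -> R) (u v : V -> R -> R) :
  system_solution Omega G p q u0 v0 u v ->
  system_solution Omega G q p v0 u0 v u.
Proof. by case. Qed.

Lemma positive_solution (p q pstar : R) : (0 <= p)%R -> (0 <= q)%R ->
  (1 < pstar)%R ->
  (forall alpha beta A B : R, 1 <= alpha -> 1 <= beta -> 0 <= A -> 0 <= B ->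
    pstar < Num.min A B ->
    has_positive_scalar_solution Omega G alpha beta A B)%R ->
  (pstar - 1 < (p * q - 1) / (Num.max p q + 1))%R ->
  exists u0 v0 u v,
    [/\ initial_function Omega u0, initial_function Omega v0,
        system_solution Omega G p q u0 v0 u v,
        positive_on Omega u & positive_on Omega v].
Proof.
move=> p0 q0 pstar1 hscalar; have [qp|/ltW pq] := leP q p.
  exact: positive_solution_ordered.
rewrite (mulrC p) => h.
have [u0 [v0 [u [v [iu iv sol pu pv]]]]] :=
  positive_solution_ordered p0 pq pstar1 hscalar h.
exists v0, u0, v, u.
split; [exact: iv|exact: iu|exact: system_solution_sym|exact: pv|exact: pu].
Qed.

End positive_solutions.

Theorem theorem3p2 (R : realType) (N : nat) (hN : (1 <= N)%N)
    (Omega : set 'rV[R]_N) (hOmega : smooth_domain Omega)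
    (G : R -> 'rV[R]_N -> 'rV[R]_N -> R) (hG : dirichlet_heat_kernel Omega G)
    (p q : R) (hp : 0 <= p) (hq : 0 <= q) :
  (p * q <= 1 ->
    forall u0 v0 : 'rV[R]_N -> R,
      ess_bounded Omega u0 -> ess_bounded Omega v0 ->
      (forall x, Omega x -> 0 <= u0 x) -> (forall x, Omega x -> 0 <= v0 x) ->
      exists u v, system_solution Omega G p q u0 v0 u v)
  /\
  (forall pstar : R, 1 < pstar ->
    (forall alpha beta A B : R,
      1 <= alpha -> 1 <= beta -> 0 <= A -> 0 <= B ->
      1 < Num.min A B -> Num.min A B <= pstar ->
      ~ has_positive_scalar_solution Omega G alpha beta A B) ->
    (forall alpha beta A B : R,
      1 <= alpha -> 1 <= beta -> 0 <= A -> 0 <= B ->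
      pstar < Num.min A B ->
      has_positive_scalar_solution Omega G alpha beta A B) ->
    (p * q - 1) / (Num.max p q + 1) > pstar - 1 ->
    exists u0 v0 u v,
      [/\ initial_function Omega u0, initial_function Omega v0,
          system_solution Omega G p q u0 v0 u v,
          positive_on Omega u & positive_on Omega v]).
Proof.
have [oOmega _ Omega0 _] := hOmega.
split=> [pq1 u0 v0|pstar pstar1 _ hscalar hpq].
  exact: (global_solution_bounded_data oOmega hG).
exact: (positive_solution oOmega hG Omega0 hp hq pstar1 hscalar hpq).
Qed.
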